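(* For a dispatch stage $r\in\{1,\dots,R\}$, the expected cost-to-go function at stage $R+1$ given the information at stage $r$, $\hat J_{R+1}(x_{R+1})=\mathbb{E}[J_{R+1}(x_{R+1})\mid Y_r]$, is $$\hat J_{R+1}(x_{R+1})=c\,\mathbb{E}\left[\sum_{t\in\mathcal{T}}\sum_{k\in\mathcal{K}_t}[D_t^k-x]_+\,p_t^k\,\middle|\,Y_r\right] =c\,\mathbb{E}\left[\sum_{t\in\mathcal{T}}\sum_{k\in\mathcal{K}_t}\sum_{j\in\mathcal{N}_t^k}(D_t^k-x)\,\mathbb{1}\{(\underline{\mathbf{D}_t^k})_j<\mathbf{D}_t\le(\overline{\mathbf{D}_t^k})_j\}\,\middle|\,Y_r\right],$$ where $\mathbf{D}_t=(D_{R+1}^1,D_{R+2}^1,D_{R+2}^2,D_{R+2}^3,\dots,D_t^1,\dots,D_t^{K_t})^{\mathrm T}$, and $(\underline{\mathbf{D}_t^k})_j$, $(\overline{\mathbf{D}_t^k})_j$ are the columns of matrices $\underline{\mathbf{D}_t^k},\overline{\mathbf{D}_t^k}$ of size $(t-R)^2\times|\mathcal{N}_t^k|$ chosen such that $$\mathbb{1}\{D_t^k>x\}\,p_t^k=\sum_{j\in\mathcal{N}_t^k}\mathbb{1}\{(\underline{\mathbf{D}_t^k})_j<\mathbf{D}_t\le(\overline{\mathbf{D}_t^k})_j\},$$ each element of $\mathcal{N}_t^k$ representing a path from the root node to node $D_t^k$ in the lattice. The constrained subgradient of the cost-to-go function at stage $R+1$ given the information at dispatch stage $r$ is $$\begin{aligned}\nabla\hat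 J_{R+1}(x_{R+1})=-\frac cT\sum_{t\in\mathcal{T}}\sum_{k\in\mathcal{K}_t}\sum_{j\in\mathcal{N}_t^k}\Bigg\{&\min(k,K_t+1-k)\,\mathbb{E}\left[\mathbb{1}\{(\underline{\mathbf{D}_t^k})_j<\mathbf{D}_t\le(\overline{\mathbf{D}_t^k})_j\}\,\middle|\,Y_r\right]\\ &+\sum_{i=1}^{(t-R)^2}\mathbb{E}\bigg[(D_t^k-x)\left(\frac{d(\overline{\mathbf{D}_t^k})_{i,j}}{dx}\mathbb{1}\{(\mathbf{D}_t)_i=(\overline{\mathbf{D}_t^k})_{i,j}\}-\frac{d(\underline{\mathbf{D}_t^k})_{i,j}}{dx}\mathbb{1}\{(\mathbf{D}_t)_i=(\underline{\mathbf{D}_t^k})_{i,j}\}\right)\\ &\qquad\qquad\times\mathbb{1}\{(\underline{\mathbf{D}_t^k})_{-i,j}<(\mathbf{D}_t)_{-i}\le(\overline{\mathbf{D}_t^k})_{-i,j}\}\,\bigg|\,Y_r\bigg]\Bigg\},\end{aligned}$$ where $(\mathbf{D}_t)_i$, $(\underline{\mathbf{D}_t^k})_{i,j}$, $(\overline{\mathbf{D}_t^k})_{i,j}$ are the $i$-th entries of $\mathbf{D}_t$, $(\underline{\mathbf{D}_t^k})_j$, $(\overline{\mathbf{D}_t^k})_j$ respectively, and $(\mathbf{D}_t)_{-i}$, $(\underline{\mathbf{D}_t^k})_{-i,j}$, $(\overline{\mathbf{D}_t^k})_{-i,j}$ are the remaining parts of the corresponding vectors.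
   Context: Write $[a]_+=\max(a,0)$. Storage operation stages: $\mathcal{T}=\{R+1,\dots,R+T\}$; dispatch stages $1,\dots,R$. Information sets are nested: $Y_1\subset\dots\subset Y_{R+T+1}$. $D_t$, $t\in\mathcal{T}$, is the random (exogenous, real-valued) net deficit, observed at stage $t$ ($D_t$ is $Y_t$-measurable). Given accumulated energy $x_{R+1}$, the supply at each $t\in\mathcal{T}$ is $x=x_{R+1}/T$. The unit shortfall cost is a constant $c>0$. Storage is ideal (efficiencies $1$) with capacity $B$: $b_{R+1}=0$, $b_{t+1}=b_t+u_t$, with $Y_t$-adapted controls satisfying $-b_t\le u_t\le B-b_t$. The cost-to-go is $$J_{R+1}(x_{R+1})=\inf_{\mathbf{u}}\mathbb{E}\left[c\sum_{t\in\mathcal{T}}[D_t-x+u_t]_+\,\middle|\,Y_{R+1}\right],$$ over feasible adapted $\mathbf{u}=(u_{R+1},\dots,u_{R+T})$. The symbol $\nabla$ denotes the (constrained) subgradient with respect to $x_{R+1}$. Let $K_t=2(t-R)-1$ and $\mathcal{K}_t=\{1,\dots,K_t\}$. Define $D_{R+1}^1=D_{R+1}$ and, for $t>R+1$, $D_t^1=D_t$, $D_t^k=D_t-(x-D_{t-1}^{k-1})$ for $1<k<K_t$, and $D_t^{K_t}=D_t-B$. Define $p_{R+1}^1=1$ and, for $t>R+1$, $p_t^1=\sum_{l\in\mathcal{K}_{t-1}}p_{t-1}^l\mathbb{1}\{D_{t-1}^l>x\}$, $p_t^k=p_{t-1}^{k-1}\mathbb{1}\{x-B<D_{t-1}^{k-1}\le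 x\}$ for $1<k<K_t$, and $p_t^{K_t}=\sum_{l\in\mathcal{K}_{t-1}}p_{t-1}^l\mathbb{1}\{D_{t-1}^l\le x-B\}$. The lattice has nodes $(t,k)$, $t\in\mathcal{T}$, $k\in\mathcal{K}_t$ (node $(t,k)$ corresponds to $D_t^k$), root $(R+1,1)$, and each node $(t,k)$ with $t<R+T$ has three children: left $(t+1,1)$, taken when $D_t^k>x$; middle $(t+1,k+1)$, taken when $x-B<D_t^k\le x$; right $(t+1,K_{t+1})$, taken when $D_t^k\le x-B$. Vector inequalities are componentwise. Entries of $\underline{\mathbf{D}_t^k}$ and $\overline{\mathbf{D}_t^k}$ are lower and upper bounds on the components of $\mathbf{D}_t$ along the path; they may be $\mp\infty$ when no bound is imposed (such entries do not depend on $x$ and have derivative $0$). *)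

(* Defs.v *)
From HB Require Import structures.
From mathcomp Require Import all_boot all_order all_algebra.
From mathcomp Require Import all_classical all_reals all_analysis.

Set Implicit Arguments.
Unset Strict Implicit.
Unset Printing Implicit Defensive.

Import Order.TTheory GRing.Theory Num.Theory.
Import numFieldNormedType.Exports.

Local Open Scope classical_set_scope.
Local Open Scope ring_scope.

Section conditional_expectation.
Context {d : measure_display} {Omega : measurableType d} {R : realType}.
Variable P : probability Omega R.

(* [G] is meant to be a sigma-algebra, so that [<<s G >>] is [G] itself. *)
Definition measurable_wrt (G : set (set Omega)) (f : Omega -> R) : Prop :=
  measurable_fun setT (f : g_sigma_algebraType G -> R).

Definition is_condexp (G : set (set Omega)) (X Z : Omega -> R) : Prop :=
  [/\ P.-integrable setT (EFin \o X),
      P.-integrable setT (EFin \o Z),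
      measurable_wrt G Z &
      forall A, G A ->
        (\int[P]_(w in A) (Z w)%:E = \int[P]_(w in A) (X w)%:E)%E].

(* A chosen version of E[X | G], determined up to a P-null set; it is the zero
   function when X is not integrable. *)
Definition condexp (G : set (set Omega)) (X : Omega -> R) : Omega -> R :=
  xget (fun=> 0) [set Z | is_condexp G X Z].

(* The infimum of a family of G-measurable random variables (such as conditional
   expectations given G) is the greatest lower bound for the almost sure order. *)
Definition is_essential_inf (G : set (set Omega)) (F : set (Omega -> R))
    (J : Omega -> R) : Prop :=
  [/\ measurable_wrt G J,
      forall Z, F Z -> {ae P, forall w, J w <= Z w} &
      forall J', measurable_wrt G J' ->
        (forall Z, F Z -> {ae P, forall w, J' w <= Z w}) ->
        {ae P, forall w, J' w <= J w}].

Definition essential_inf (G : set (set Omega)) (F : set (Omega -> R)) :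
    Omega -> R :=
  xget (fun=> 0) [set J | is_essential_inf G F J].

End conditional_expectation.

Definition constrained_subgradient {R : realType} (X : set R) (f : R -> R)
    (x g : R) : Prop :=
  X x /\ forall y, X y -> f x + g * (y - x) <= f y.

Section storage.
Context {d : measure_display} {Omega : measurableType d} {R : realType}.
Variables (P : probability Omega R) (Rd T : nat) (Y : nat -> set (set Omega)).
Variables (D : nat -> Omega -> R) (B c : R).

(* Rd is the number of dispatch stages and T the number of storage stages. *)
Definition storage_stage (t : nat) : bool := (Rd < t <= Rd + T)%N.

Definition feasible (u : nat -> Omega -> R) : Prop :=
  (forall t, storage_stage t -> measurable_wrt (Y t) (u t)) /\
  exists b : nat -> Omega -> R,
    (forall w, b Rd.+1 w = 0) /\
    (forall t w, storage_stage t ->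
      b t.+1 w = b t w + u t w /\ - b t w <= u t w <= B - b t w).

Definition storage_cost (xR1 : R) (u : nat -> Omega -> R) (w : Omega) : R :=
  c * \sum_(Rd.+1 <= t < (Rd + T).+1)
        Num.max (D t w - xR1 / T%:R + u t w) 0.

Definition cost_to_go (xR1 : R) : Omega -> R :=
  essential_inf P (Y Rd.+1)
    [set condexp P (Y Rd.+1) (storage_cost xR1 u) | u in feasible].

Definition expected_cost_to_go (r : nat) (xR1 : R) : Omega -> R :=
  condexp P (Y r) (cost_to_go xR1).

End storage.

Section lattice.
Variable Rd : nat.

Definition width (t : nat) : nat := (2 * (t - Rd) - 1)%N.

(* The pair (t, k) stands for the k-th node of stage t, both counted from 1. *)
Definition node : Type := (nat * nat)%type.

Definition root : node := (Rd.+1, 1%N).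
Definition left_child (v : node) : node := (v.1.+1, 1%N).
Definition middle_child (v : node) : node := (v.1.+1, v.2.+1).
Definition right_child (v : node) : node := (v.1.+1, width v.1.+1).
Definition children (v : node) : seq node :=
  [:: left_child v; middle_child v; right_child v].

(* All the paths with n edges starting at the root, as sequences of nodes. *)
Fixpoint root_paths (n : nat) : seq (seq node) :=
  if n is n'.+1 then
    [seq rcons q v | q <- root_paths n', v <- children (last root q)]
  else [:: [:: root]].

(* The index set N_t^k: the paths from the root to (t, k). *)
Definition paths_to (t k : nat) : seq (seq node) :=
  [seq q <- root_paths (t - Rd.+1) | last root q == (t, k)].

(* (R+1,1), (R+2,1), (R+2,2), (R+2,3), ..., (t,1), ..., (t,K_t): this sequence
   has (t - R)^2 entries. *)
Definition nodes_upto (t : nat) : seq node :=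
  [seq (s, m) | s <- iota Rd.+1 (t - Rd), m <- iota 1 (width s)].

End lattice.

Section lattice_deficits.
Context {Omega : Type} {R : realType}.
Variables (Rd : nat) (D : nat -> Omega -> R) (B : R).

(* D_t^k; the value is irrelevant unless R < t and 1 <= k <= K_t. *)
Fixpoint deficit (x : R) (t k : nat) (w : Omega) : R :=
  if t is s.+1 then
    if (s <= Rd)%N then D t w
    else if k == 1%N then D t w
    else if k == width Rd t then D t w - B
    else D t w - (x - deficit x s k.-1 w)
  else 0.

(* p_t^k; the value is irrelevant unless R < t and 1 <= k <= K_t. *)
Fixpoint weight (x : R) (t k : nat) (w : Omega) : R :=
  if t is s.+1 then
    if (s <= Rd)%N then 1
    else if k == 1%N then
      \sum_(1 <= l < (width Rd s).+1)
        weight x s l w * (x < deficit x s l w)%R%:R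
    else if k == width Rd t then
      \sum_(1 <= l < (width Rd s).+1)
        weight x s l w * (deficit x s l w <= x - B)%R%:R
    else weight x s k.-1 w * (x - B < deficit x s k.-1 w <= x)%R%:R
  else 0.

Definition deficit_vector (x : R) (t : nat) (w : Omega) :
    'cV[R]_((t - Rd) ^ 2) :=
  \col_i (let v := nth (root Rd) (nodes_upto Rd t) i in deficit x v.1 v.2 w).

(* Bounds put by the path q on the deficit at node v. Unless v is off the path,
   they are the condition for leaving v towards the next node of q: the interval
   ]x, +oo] for the left child, ]x - B, x] for the middle one, ]-oo, x - B] for
   the right one. At the last node of q the condition is the one of the left
   child, accounting for the factor 1{D_t^k > x}. A path has one node per stage,
   so that the next node of q is the child of v which belongs to q. *)
Definition lower_bound (x : R) (q : seq node) (v : node) : \bar R :=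
  if v \notin q then -oo%E
  else if middle_child v \in q then (x - B)%:E
  else if right_child Rd v \in q then -oo%E
  else x%:E.

Definition upper_bound (x : R) (q : seq node) (v : node) : \bar R :=
  if v \notin q then +oo%E
  else if middle_child v \in q then x%:E
  else if right_child Rd v \in q then (x - B)%:E
  else +oo%E.

Definition lower_mx (x : R) (t k : nat) :
    'M[\bar R]_((t - Rd) ^ 2, size (paths_to Rd t k)) :=
  \matrix_(i, j) lower_bound x (nth [::] (paths_to Rd t k) j)
                   (nth (root Rd) (nodes_upto Rd t) i).

Definition upper_mx (x : R) (t k : nat) :
    'M[\bar R]_((t - Rd) ^ 2, size (paths_to Rd t k)) :=
  \matrix_(i, j) upper_bound x (nth [::] (paths_to Rd t k) j)
                   (nth (root Rd) (nodes_upto Rd t) i).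

(* [fine] maps the infinite entries to 0, so that their derivative is 0. *)
Definition dlower (x : R) (t k : nat) (i : 'I_((t - Rd) ^ 2))
    (j : 'I_(size (paths_to Rd t k))) : R :=
  derive1 (fun y : R => fine (lower_mx y t k i j)) x.

Definition dupper (x : R) (t k : nat) (i : 'I_((t - Rd) ^ 2))
    (j : 'I_(size (paths_to Rd t k))) : R :=
  derive1 (fun y : R => fine (upper_mx y t k i j)) x.

Definition in_box (x : R) (t k : nat) (j : 'I_(size (paths_to Rd t k)))
    (w : Omega) : bool :=
  [forall i, (lower_mx x t k i j < (deficit_vector x t w i 0)%:E
                <= upper_mx x t k i j)%E].

Definition in_box_except (x : R) (t k : nat) (i : 'I_((t - Rd) ^ 2))
    (j : 'I_(size (paths_to Rd t k))) (w : Omega) : bool :=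
  [forall i', (i' != i) ==>
     (lower_mx x t k i' j < (deficit_vector x t w i' 0)%:E
        <= upper_mx x t k i' j)%E].

End lattice_deficits.

(* Main.v *)
Require Import Defs.
From HB Require Import structures.
From mathcomp Require Import all_boot all_order all_algebra.
From mathcomp Require Import all_classical all_reals all_analysis.
From mathcomp Require Import measurable_realfun lra ring zify.

Set Implicit Arguments.
Unset Strict Implicit.
Unset Printing Implicit Defensive.

Import Order.TTheory GRing.Theory Num.Theory.
Import numFieldNormedType.Exports.

Local Open Scope classical_set_scope.
Local Open Scope ring_scope.

(** Discharging as much as possible in a shortage and charging as much as
    possible in a surplus is optimal for every outcome, and the lattice records
    its state: exactly one node of every stage [t] has weight 1, namely the one
    whose deficit is [D_t] minus the stored energy. Linear programming duality
    makes this quantitative. Let [lam_t] be 1 in a shortage, [lam_(t+1)] when the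
    storage is neither emptied nor filled, and 0 when it is filled. An Abel
    summation bounds the cost of any feasible control at supply [y] from below
    by the greedy cost at supply [x] minus [(y - x)] times the sum of the
    [lam_t]. At [y = x] this is the optimality of the greedy policy, and in
    general it is a pathwise subgradient inequality. The sum of the [lam_t] is
    also the sum, over the shortages, of the number [min(k, K_t+1-k)] of stages
    since the storage was last empty or full.

    The terms with derivatives of the bounds cancel pathwise, since two paths
    which part at a threshold reached with equality have the same later
    deficits; they are integrable because on the corresponding events the
    deficit is at most [D_t].

    Finally, the greedy cost is Lipschitz in the supply uniformly in the
    outcome, so that its conditional expectations at rational supplies extend to
    a version with continuous paths, for which almost sure inequalities at
    rational points hold at all points. *)

(** * Conditional expectations *)

Section conditional_expectation_theory.
Context {d : measure_display} {Omega : measurableType d} {R : realType}.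
Variable P : probability Omega R.
Implicit Types (G H : set (set Omega)) (X Z : Omega -> R).

Lemma measurable_wrt_sub G H X : sigma_algebra setT H -> G `<=` H ->
  measurable_wrt G X -> measurable_wrt H X.
Proof.
move=> sH GH mX mT A mA; have := mX measurableT A mA.
by rewrite /measurable/=; apply: smallest_sub => // B /GH; exact: sub_gen_smallest.
Qed.

Lemma measurable_wrt_measurable G X : G `<=` measurable ->
  measurable_wrt G X -> measurable_fun setT X.
Proof.
move=> Gm mX mT A mA; have := mX measurableT A mA.
by rewrite {1}/measurable/=; apply: smallest_sub => //; exact: sigma_algebra_measurable.
Qed.

Lemma integrable_ae_eq X Z : P.-integrable setT (EFin \o X) ->
  measurable_fun setT Z -> {ae P, forall w, Z w = X w} ->
  P.-integrable setT (EFin \o Z).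
Proof.
move=> /integrableP[mX iX] mZ XZ; apply/integrableP; split.
  exact/measurable_EFinP.
have mZ' : measurable_fun setT (abse \o (EFin \o Z)).
  by apply: measurableT_comp => //; exact/measurable_EFinP.
have mX' : measurable_fun setT (abse \o (EFin \o X)) by exact: measurableT_comp.
rewrite (ae_eq_integral (abse \o (EFin \o X))) //=.
by apply: filterS XZ => w /= ->.
Qed.

Section one_sigma_algebra.
Variable G : set (set Omega).
Hypotheses (sG : sigma_algebra setT G) (Gm : G `<=` measurable).

Let Gs (A : set Omega) : (measurable : set (set (g_sigma_algebraType G))) A -> G A.
Proof. by rewrite /measurable/= sigma_algebra_id. Qed.

(** With [f] the identity, this is the identity map onto the space that carries only [G]; the law of
    [P] under it is the restriction of [P] to [G]. *)
Let sub (f : Omega -> Omega) : Omega -> g_sigma_algebraType G := f.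

Let measurable_sub : measurable_fun setT (sub id).
Proof. by move=> _ A /Gs /Gm mA; rewrite setTI. Qed.

(** Radon-Nikodym on [G]: the charge with density [X], restricted to [G], is dominated by the
    restriction of [P], and its density there is the conditional expectation. *)
Lemma is_condexp_exists X : P.-integrable setT (EFin \o X) ->
  exists Z, is_condexp P G X Z.
Proof.
move=> iX.
pose mf := isMeasurableFun.Build _ _ _ _ _ measurable_sub.
pose j : {mfun Omega >-> g_sigma_algebraType G} := HB.pack (sub id) mf.
pose mu := distribution P j.
pose nu0 : set (g_sigma_algebraType G) -> \bar R := induced_charge iX.
have nu00 : nu0 set0 = 0%E by exact: (charge0 (induced_charge iX)).
have nu0fin A : measurable A -> nu0 A \is a fin_num.
  by move=> /Gs/Gm mA; exact: (fin_num_measure (induced_charge iX)).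
have nu0add : semi_sigma_additive nu0.
  move=> F mF tF /Gs/Gm mUF.
  by apply: (@charge_semi_sigma_additive _ _ _ (induced_charge iX)) => // i;
    exact/Gm/Gs.
pose nuC := isCharge.Build _ _ _ nu0 nu00 nu0fin nu0add.
pose nu : {charge set (g_sigma_algebraType G) -> \bar R} := HB.pack nu0 nuC.
have numu : nu `<< mu.
  apply/null_content_dominatesP => A mA muA.
  rewrite /nu/= /pushforward /induced_charge/=.
  apply: null_set_integral => //; first exact/Gm/Gs.
  by apply: measurable_funTS; exact: measurable_int iX.
have iRN := Radon_Nikodym_integrable numu.
pose Z : Omega -> R := fine \o Radon_Nikodym nu mu.
have ZE w : (Z w)%:E = Radon_Nikodym nu mu w.
  by rewrite /Z/= fineK//; exact: Radon_Nikodym_fin_num.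
have mZ : measurable_wrt G Z.
  apply/measurable_EFinP.
  rewrite (_ : _ \o _ = Radon_Nikodym nu mu); last exact/funext.
  exact: measurable_int iRN.
have iZ : P.-integrable setT (EFin \o Z).
  apply/integrableP; split.
    exact/measurable_EFinP/(measurable_wrt_measurable Gm).
  have /integrableP[_] := iRN.
  rewrite ge0_integral_distribution//=.
    by under eq_integral do rewrite -ZE.
  by apply: measurableT_comp => //; exact: measurable_int iRN.
exists Z; split => // A GA.
have mA : (measurable : set (set (g_sigma_algebraType G))) A.
  exact: sub_gen_smallest.
rewrite -[RHS]/(nu A) (Radon_Nikodym_integral numu mA) integral_pushforward//=.
- by apply: eq_integral => w _; rewrite -ZE.
- have : P.-integrable (sub id @^-1` A) (EFin \o Z).
    by apply: integrableS iZ => //; exact/Gm.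
  by apply: eq_integrable => [|w _]; [exact/Gm|exact: ZE].
Qed.

Lemma is_condexp_condexp X : P.-integrable setT (EFin \o X) ->
  is_condexp P G X (condexp P G X).
Proof. by move=> /is_condexp_exists/(@xgetPex _ (fun=> 0)). Qed.

(** The event [Z' < Z] belongs to [G], so the integrals of [Z] and [Z'] over it are those of [X] and
    [X']; their order forces the event to be null. *)
Lemma is_condexp_le X X' Z Z' : is_condexp P G X Z -> is_condexp P G X' Z' ->
  {ae P, forall w, X w <= X' w} -> {ae P, forall w, Z w <= Z' w}.
Proof.
move=> [iX iZ mZ ZE] [iX' iZ' mZ' ZE'] XX'.
pose A := [set w | Z' w < Z w].
have GA : G A.
  have := measurable_fun_ltr mZ' mZ measurableT (Y := [set true]).
  by rewrite setTI => mA; apply: Gs; apply: mA.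
have mA := Gm GA.
have iA f : P.-integrable setT (EFin \o f) -> P.-integrable A (EFin \o f).
  by move=> iF; apply: integrableS iF.
have XX'A : (\int[P]_(w in A) (X w)%:E <= \int[P]_(w in A) (X' w)%:E)%E.
  have mX : measurable_fun setT X by exact/measurable_EFinP/measurable_int/iX.
  have mX' : measurable_fun setT X' by exact/measurable_EFinP/measurable_int/iX'.
  (* Comparing integrals calls for an inequality at every point, so [X] is replaced by the almost
     surely equal minimum. *)
  pose X1 := X \min X'.
  have X1X : {ae P, forall w, X1 w = X w}.
    by apply: filterS XX' => w /min_idPl.
  have mX1 : measurable_fun setT X1 by exact: measurable_minr.
  have iX1 := integrable_ae_eq iX mX1 X1X.
  rewrite (ae_eq_integral (EFin \o X1)) //=.
  - apply: le_integral => //; [exact: (iA _ iX1)|exact: (iA _ iX')|] => w _.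
    by rewrite lee_fin ge_min lexx orbT.
  - by apply: measurable_funTS; exact: measurable_int iX.
  - by apply: measurable_funTS; exact: measurable_int iX1.
  - by apply: filterS X1X => w /= ->.
have ZZ'A : (\int[P]_(w in A) `|(Z w - Z' w)%:E| = 0)%E.
  apply/eqP; rewrite eq_le integral_ge0 ?andbT//.
  rewrite (eq_integral (fun w => (Z w)%:E - (Z' w)%:E)%E); last first.
    move=> w /[!inE] wA; rewrite -EFinB gee0_abs// lee_fin subr_ge0; exact: ltW.
  rewrite (integralB mA (iA _ iZ) (iA _ iZ')) ZE// ZE'// sube_le0//.
have ZZ'0 : ae_eq P A (fun w => (Z w - Z' w)%:E) (cst 0%E).
  apply/ae_eq_integral_abs => //.
  exact: measurable_int (integrableB mA (iA _ iZ) (iA _ iZ')).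
apply: filterS ZZ'0 => w /= ZZ'w; rewrite leNgt; apply/negP => wA.
by move: (ZZ'w wA) => []/eqP; rewrite subr_eq0 => /eqP ZZ'; move: wA; rewrite ZZ' ltxx.
Qed.

Lemma is_condexp_unique X X' Z Z' : is_condexp P G X Z -> is_condexp P G X' Z' ->
  {ae P, forall w, X w = X' w} -> {ae P, forall w, Z w = Z' w}.
Proof.
move=> XZ XZ' XX'.
have ZleZ' : {ae P, forall w, Z w <= Z' w}.
  by apply: is_condexp_le XZ XZ' _; apply: filterS XX' => w ->.
have Z'leZ : {ae P, forall w, Z' w <= Z w}.
  by apply: is_condexp_le XZ' XZ _; apply: filterS XX' => w ->.
by apply: filterS2 ZleZ' Z'leZ => w ? ?; apply/eqP; rewrite eq_le; apply/andP.
Qed.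

Lemma is_condexp_ae_eq X X' Z Z' : is_condexp P G X Z ->
  measurable_fun setT X' -> {ae P, forall w, X' w = X w} ->
  measurable_wrt G Z' -> {ae P, forall w, Z' w = Z w} -> is_condexp P G X' Z'.
Proof.
move=> [iX iZ mZ ZE] mX' XX' mZ' ZZ'.
have iX' := integrable_ae_eq iX mX' XX'.
have iZ' := integrable_ae_eq iZ (measurable_wrt_measurable Gm mZ') ZZ'.
have mI f A : P.-integrable setT (EFin \o f) -> measurable_fun A (EFin \o f).
  by move=> /measurable_int iF; exact: measurable_funTS.
split => // A GA; have mA := Gm GA.
have ZZ'A : ae_eq P A (EFin \o Z') (EFin \o Z) by apply: filterS ZZ' => w /= ->.
have XX'A : ae_eq P A (EFin \o X) (EFin \o X') by apply: filterS XX' => w /= ->.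
have := ae_eq_integral _ _ mA (mI _ _ iZ') (mI _ _ iZ) ZZ'A.
have := ae_eq_integral _ _ mA (mI _ _ iX) (mI _ _ iX') XX'A.
by move=> /= <- ->; exact: ZE.
Qed.

Lemma is_condexpD X X' Z Z' : is_condexp P G X Z -> is_condexp P G X' Z' ->
  is_condexp P G (X \+ X') (Z \+ Z').
Proof.
move=> [iX iZ mZ ZE] [iX' iZ' mZ' ZE'].
have iA f A : G A -> P.-integrable setT (EFin \o f) -> P.-integrable A (EFin \o f).
  by move=> /Gm mA iF; apply: integrableS iF.
split.
- exact: (integrableD measurableT iX iX').
- exact: (integrableD measurableT iZ iZ').
- exact: measurable_funD.
- move=> A GA; have mA := Gm GA.
  rewrite (integralD mA (iA _ _ GA iZ) (iA _ _ GA iZ')).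
  by rewrite (integralD mA (iA _ _ GA iX) (iA _ _ GA iX')) ZE// ZE'.
Qed.

Lemma is_condexpZ a X Z : is_condexp P G X Z ->
  is_condexp P G (fun w => a * X w) (fun w => a * Z w).
Proof.
move=> [iX iZ mZ ZE].
have iA f A : G A -> P.-integrable setT (EFin \o f) -> P.-integrable A (EFin \o f).
  by move=> /Gm mA iF; apply: integrableS iF.
split.
- exact: (integrableZl measurableT a iX).
- exact: (integrableZl measurableT a iZ).
- exact: measurable_funM.
- move=> A GA; have mA := Gm GA.
  rewrite (integralZl mA (iA _ _ GA iZ)) (integralZl mA (iA _ _ GA iX)).
  by rewrite ZE.
Qed.

Lemma is_condexp_cst a : is_condexp P G (cst a) (cst a).
Proof.
have ia : P.-integrable setT (EFin \o cst a).
  exact: finite_measure_integrable_cst.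
by split => //; exact: measurable_cst.
Qed.

Lemma is_condexp_sum (I : eqType) (s : seq I) (X Z : I -> Omega -> R) :
  (forall i, i \in s -> is_condexp P G (X i) (Z i)) ->
  is_condexp P G (fun w => \sum_(i <- s) X i w) (fun w => \sum_(i <- s) Z i w).
Proof.
elim: s => [|i s IHs] XZ.
  under eq_fun do rewrite big_nil.
  by under [X in is_condexp _ _ _ X]eq_fun do rewrite big_nil; exact: is_condexp_cst.
under eq_fun do rewrite big_cons.
under [X in is_condexp _ _ _ X]eq_fun do rewrite big_cons.
apply: is_condexpD; first by apply: XZ; rewrite mem_head.
by apply: IHs => j js; apply: XZ; rewrite inE js orbT.
Qed.

Lemma is_condexp_tower H X Z W : H `<=` G ->
  is_condexp P G X Z -> is_condexp P H Z W -> is_condexp P H X W.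
Proof.
move=> HG [iX iZ mZ ZE] [_ iW mW WE]; split => // A HA.
by rewrite WE// ZE//; exact: HG.
Qed.

(** [X] and [Z] have the same integrals over the sets of [H], so that a conditional expectation of
    one given [H] is also one of the other. *)
Lemma is_condexp_tower_inv H X Z W : H `<=` G ->
  is_condexp P G X Z -> is_condexp P H X W -> is_condexp P H Z W.
Proof.
move=> HG [_ iZ _ ZE] [_ iW mW WE]; split => // A HA.
by rewrite WE// ZE//; exact: HG.
Qed.

End one_sigma_algebra.

End conditional_expectation_theory.

(** * Essential infima, and versions of conditional expectations with continuous paths *)

Section versions.
Context {d : measure_display} {Omega : measurableType d} {R : realType}.
Variable P : probability Omega R.
Implicit Types (G : set (set Omega)) (X Z : Omega -> R).

Lemma integrable_dominated X Z : measurable_fun setT X ->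
  (forall w, `|X w| <= Z w) -> P.-integrable setT (EFin \o Z) ->
  P.-integrable setT (EFin \o X).
Proof.
move=> mX XZ iZ; apply: le_integrable iZ => //; first exact/measurable_EFinP.
by move=> w _ /=; rewrite lee_fin (le_trans (XZ w))// ler_norm.
Qed.

(** A member that is almost surely below all the others is itself an essential infimum, which
    settles existence; the greatest lower bound property gives uniqueness up to null sets. *)
Lemma essential_inf_min G (F : set (Omega -> R)) Z : F Z ->
  measurable_wrt G Z -> (forall Z', F Z' -> {ae P, forall w, Z w <= Z' w}) ->
  measurable_wrt G (essential_inf P G F) /\
  {ae P, forall w, essential_inf P G F w = Z w}.
Proof.
move=> FZ mZ Zmin.
have Zinf : is_essential_inf P G F Z by split => // J' _; exact.
have [mJ Jlb Jglb] := xgetPex (fun=> 0) (ex_intro (is_essential_inf P G F) _ Zinf).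
split => //; have := Jglb _ mZ Zmin; have := Jlb _ FZ.
by apply: filterS2 => w ? ?; apply/eqP; rewrite eq_le; apply/andP.
Qed.

Lemma ae_forall_rat (Q : rat -> Omega -> Prop) :
  (forall q, {ae P, forall w, Q q w}) -> {ae P, forall w, forall q, Q q w}.
Proof.
move=> aeQ.
have : {ae P, forall w, forall n : nat, if unpickle n is Some q then Q q w else True}.
  apply: ae_foralln => n; case: (unpickle n) => [q|]; first exact: aeQ.
  exact: aeW.
by apply: filterS => w H q; have := H (pickle q); rewrite pickleK.
Qed.

Lemma bigcapT_measurable_rat d' (T : measurableType d') (F : rat -> set T) :
  (forall q, measurable (F q)) -> measurable (\bigcap_q F q).
Proof.
move=> mF; rewrite -[X in measurable X]setCK setC_bigcap; apply: measurableC.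
by apply: bigcupT_measurable_rat => q; exact: measurableC.
Qed.

Lemma exists_rat_close (y : R) (e : R) : 0 < e -> exists q : rat, `|y - ratr q| < e.
Proof.
move=> e0; have [q /=] := @rat_in_itvoo R (y - e) (y + e) ltac:(lra).
rewrite in_itv/= => /andP[? ?]; exists q; rewrite ltr_norml; lra.
Qed.

Lemma continuous_ge0_rat (h : R -> R) : continuous h ->
  (forall q : rat, 0 <= h (ratr q)) -> forall y, 0 <= h y.
Proof.
move=> hc h0 y; rewrite leNgt; apply/negP => hy.
have /cvgrPdist_lt/(_ (- h y)) := hc y.
rewrite oppr_gt0 => /(_ hy) /nbhs_ballP[e /= e0 he].
have [q yq] := exists_rat_close y e0.
by have := he _ yq; have := h0 q; rewrite ltr_norml /=; lra.
Qed.

Section lipschitz_version.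
Variables (G : set (set Omega)) (f : R -> Omega -> R) (L : R).
Hypotheses (sG : sigma_algebra setT G) (Gm : G `<=` measurable).
Hypothesis f_int : forall y, P.-integrable setT (EFin \o f y).
Hypothesis f_lip : forall y z w, `|f y w - f z w| <= L * `|y - z|.

Let L0 : 0 <= L.
Proof.
have := f_lip 1 0 point; rewrite subr0 normr1 mulr1; apply: le_trans.
exact: normr_ge0.
Qed.

Let Z (q : rat) : Omega -> R := condexp P G (f (ratr q)).

Let ZP q : is_condexp P G (f (ratr q)) (Z q).
Proof. exact: is_condexp_condexp. Qed.

Let mZ q : measurable_wrt G (Z q). Proof. by case: (ZP q). Qed.

Lemma condexp_dist y z W W' : is_condexp P G (f y) W -> is_condexp P G (f z) W' ->
  {ae P, forall w, `|W w - W' w| <= L * `|y - z|}.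
Proof.
move=> WP WP'.
have cP : is_condexp P G (cst (L * `|y - z|)) (cst (L * `|y - z|)).
  exact: is_condexp_cst.
have le1 : {ae P, forall w, (W' \+ cst (L * `|y - z|)) w >= W w}.
  apply: (is_condexp_le sG Gm WP (is_condexpD Gm WP' cP)).
  by apply: aeW => w /=; have := f_lip y z w; rewrite ler_norml; lra.
have le2 : {ae P, forall w, (W \+ cst (L * `|y - z|)) w >= W' w}.
  apply: (is_condexp_le sG Gm WP' (is_condexpD Gm WP cP)).
  by apply: aeW => w /=; have := f_lip y z w; rewrite ler_norml; lra.
by apply: filterS2 le1 le2 => w /= ? ?; rewrite ler_norml; lra.
Qed.

(** The almost sure event on which the chosen versions at rational points are jointly Lipschitz.
    Setting them to zero elsewhere keeps them measurable for [G] and makes them Lipschitz for every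
    outcome. *)
Let good : set Omega :=
  \bigcap_(q : rat) \bigcap_(q' : rat)
    [set w | `|Z q w - Z q' w| <= L * `|ratr q - ratr q'|].

Let Z' (q : rat) (w : Omega) : R := Z q w * \1_good w.

Let mZ' q : measurable_wrt G (Z' q).
Proof.
apply: measurable_funM; first exact: mZ.
apply: measurable_indic; apply: bigcapT_measurable_rat => q1.
apply: bigcapT_measurable_rat => q2.
have : measurable_fun setT
    ((fun w => `|Z q1 w - Z q2 w| <= L * `|ratr q1 - ratr q2|)
      : g_sigma_algebraType G -> bool).
  apply: measurable_fun_ler; last exact: measurable_cst.
  by apply: measurableT_comp => //; apply: measurable_funB; exact: mZ.
by move=> /(_ measurableT [set true]); rewrite setTI; exact.
Qed.

Let Z'lip q q' w : `|Z' q w - Z' q' w| <= L * `|ratr q - ratr q'|.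
Proof.
rewrite /Z' indicE; have [wg|_] := boolP (w \in good).
  by rewrite !mulr1; move: wg; rewrite inE; exact.
by rewrite !mulr0 subrr normr0 mulr_ge0.
Qed.

Let Z'ae : {ae P, forall w, forall q, Z' q w = Z q w}.
Proof.
have : {ae P, forall w, good w}.
  have : {ae P, forall w, forall q q' : rat,
      `|Z q w - Z q' w| <= L * `|ratr q - ratr q'|}.
    by apply: ae_forall_rat => q; apply: ae_forall_rat => q'; exact: condexp_dist.
  by apply: filterS => w H q _ q' _; exact: H.
by apply: filterS => w wg q; rewrite /Z' indicE mem_set// mulr1.
Qed.

(* McShane's formula for the Lipschitz extension from the rationals. *)
Let J (y : R) (w : Omega) : R :=
  inf (range (fun q : rat => Z' q w + L * `|y - ratr q|)).

(** The Lipschitz bound on [Z'] makes the infimum finite and pins it to within [L * |y - q|] of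
    [Z' q]; at a rational [y] the extension therefore agrees with [Z']. *)
Let JZ y q w : `|J y w - Z' q w| <= L * `|y - ratr q|.
Proof.
have lb : lbound (range (fun q : rat => Z' q w + L * `|y - ratr q|))
    (Z' q w - L * `|y - ratr q|).
  move=> _ [q' _ <-]; have := Z'lip q q' w; rewrite ler_norml => /andP[_ ?].
  have : L * `|ratr q - ratr q'| <= L * (`|y - ratr q| + `|y - ratr q'|).
    apply: ler_wpM2l => //; rewrite (distrC y (ratr q)).
    by apply: le_trans (ler_normD _ _); rewrite subrKA.
  by rewrite mulrDr; lra.
have ub : J y w <= Z' q w + L * `|y - ratr q|.
  by apply: ge_inf; [exists (Z' q w - L * `|y - ratr q|)|exists q].
have : Z' q w - L * `|y - ratr q| <= J y w.
  by apply: lb_le_inf => //; exists (Z' q w + L * `|y - ratr q|), q.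
by rewrite ler_norml; lra.
Qed.

Let J_lip y z w : `|J y w - J z w| <= L * `|y - z|.
Proof.
apply/ler_addgt0Pr => e e0.
(* The summand 1 keeps the denominator positive when [L] is 0. *)
have e1 : 0 < e / (2 * L + 1) by rewrite divr_gt0//; have := L0; lra.
have [q yq] := exists_rat_close y e1.
have Jy := JZ y q w; have Jz := JZ z q w.
have zq : L * `|z - ratr q| <= L * (`|y - z| + `|y - ratr q|).
  apply: ler_wpM2l => //; rewrite (distrC y z).
  by apply: le_trans (ler_normD _ _); rewrite subrKA.
have Le : 2 * L * `|y - ratr q| <= e.
  apply: (@le_trans _ _ ((2 * L + 1) * `|y - ratr q|)).
    by rewrite ler_wpM2r//; lra.
  by rewrite mulrC -ler_pdivlMr ?ltW//; have := L0; lra.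
have tri : `|J y w - J z w| <= `|J y w - Z' q w| + `|J z w - Z' q w|.
  rewrite (distrC (J z w)).
  by apply: le_trans (ler_normD _ _); rewrite subrKA.
by lra.
Qed.

Let J_condexp y : is_condexp P G (f y) (J y).
Proof.
have /choice[s sP] : forall n : nat, exists q : rat, `|y - ratr q| < n.+1%:R^-1.
  by move=> n; apply: exists_rat_close; rewrite invr_gt0.
have mJ : measurable_wrt G (J y).
  apply: (@measurable_fun_cvg _ _ _ setT (fun n => Z' (s n) : g_sigma_algebraType G -> R)).
    by move=> n; exact: mZ'.
  move=> w _; apply/cvgrPdist_le => e e0.
  have e1 : 0 < e / (L + 1) by rewrite divr_gt0//; have := L0; lra.
  near=> n.
  apply: le_trans (JZ y (s n) w) _.
  have Ln : L * `|y - ratr (s n)| <= L * n.+1%:R^-1.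
    by apply: ler_wpM2l => //; exact: ltW.
  apply: le_trans Ln _.
  have nle : n.+1%:R^-1 <= e / (L + 1).
    apply: ltW; near: n; exact: (near_infty_natSinv_lt (PosNum e1)).
  apply: (@le_trans _ _ ((L + 1) * n.+1%:R^-1)).
    by rewrite ler_wpM2r ?invr_ge0//; lra.
  by rewrite mulrC -ler_pdivlMr//; have := L0; lra.
(* It remains to compare [J y] with a version of the conditional expectation of [f y]: outside one
   null set both are within [L * |y - q|] of [Z q] for all rational [q], hence equal. *)
apply: (is_condexp_ae_eq Gm (is_condexp_condexp sG Gm (f_int y))) => //.
- exact/measurable_EFinP/measurable_int/f_int.
- exact: aeW.
have dist : {ae P, forall w, forall q, `|condexp P G (f y) w - Z q w| <= L * `|y - ratr q|}.
  apply: ae_forall_rat => q; apply: condexp_dist => //.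
  exact: is_condexp_condexp.
apply: filterS2 dist Z'ae => w dw Zw.
apply/eqP; rewrite -subr_eq0 -normr_le0; apply/ler_addgt0Pr => e e0.
rewrite add0r.
have e1 : 0 < e / (2 * L + 1) by rewrite divr_gt0//; have := L0; lra.
have [q yq] := exists_rat_close y e1.
have Le : 2 * L * `|y - ratr q| <= e.
  apply: (@le_trans _ _ ((2 * L + 1) * `|y - ratr q|)).
    by rewrite ler_wpM2r//; lra.
  by rewrite mulrC -ler_pdivlMr ?ltW//; have := L0; lra.
have := dw q; have := JZ y q w; rewrite Zw (distrC (condexp _ _ _ _)) => J1 J2.
have tri : `|J y w - condexp P G (f y) w| <=
    `|J y w - Z q w| + `|Z q w - condexp P G (f y) w|.
  by apply: le_trans (ler_normD _ _); rewrite subrKA.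
by lra.
Unshelve. all: by end_near.
Qed.

Lemma condexp_lipschitz_version : exists J : R -> Omega -> R,
  (forall y, is_condexp P G (f y) (J y)) /\ (forall w, continuous (J ^~ w)).
Proof.
exists J; split; first exact: J_condexp.
move=> w y; apply/cvgrPdist_le => e e0.
have e1 : 0 < e / (L + 1) by rewrite divr_gt0//; have := L0; lra.
near=> z.
apply: le_trans (J_lip y z w) _.
have yz : `|y - z| <= e / (L + 1) by near: z; exact: cvgr_dist_le.
apply: (@le_trans _ _ ((L + 1) * `|y - z|)).
  by rewrite ler_wpM2r//; lra.
by rewrite mulrC -ler_pdivlMr//; have := L0; lra.
Unshelve. all: by end_near.
Qed.

End lipschitz_version.

End versions.

(** * Paths of the lattice *)

Section lattice_paths.
Variable Rd : nat.
Local Notation root := (Defs.root Rd).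
Local Notation root_paths := (root_paths Rd).

Lemma width_gt0 t : (Rd < t)%N -> (0 < width Rd t)%N.
Proof. by rewrite /width; lia. Qed.

Lemma widthS t : (Rd < t)%N -> width Rd t.+1 = (width Rd t).+2.
Proof. by rewrite /width; lia. Qed.

Definition is_node (v : node) : bool := (Rd < v.1)%N && (1 <= v.2 <= width Rd v.1)%N.

Lemma children_stage u v : v \in children Rd u -> v.1 = u.1.+1.
Proof. by rewrite !inE => /or3P[] /eqP ->. Qed.

Lemma children_is_node u v : is_node u -> v \in children Rd u -> is_node v.
Proof.
rewrite /is_node => /andP[Ru u2]; have W := widthS Ru.
by rewrite !inE => /or3P[] /eqP -> /=; rewrite W; lia.
Qed.

Lemma mem_root_pathsS n q : q \in root_paths n.+1 ->
  exists q' v, [/\ q' \in root_paths n, v \in children Rd (last root q') & q = rcons q' v].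
Proof. by case/allpairsPdep => q' [v [q'n vq' ->]]; exists q', v. Qed.

Lemma root_paths_last n q : q \in root_paths n ->
  last root q \in q /\ (last root q).1 = (Rd.+1 + n)%N.
Proof.
elim: n q => [q|n IHn q /mem_root_pathsS[q' [v [q'n vq' ->]]]].
  by rewrite inE => /eqP ->; rewrite inE eqxx addn0.
rewrite last_rcons mem_rcons mem_head (children_stage vq').
by have [_ ->] := IHn _ q'n; rewrite addnS.
Qed.

(** The stage grows by one along each edge, so only the last node has the final stage. Hence paths
    do not repeat nodes and extending a path adds a fresh one. *)
Lemma root_paths_nodes n q u : q \in root_paths n -> u \in q ->
  is_node u /\ ((u.1 <= Rd.+1 + n)%N /\ (u != last root q -> (u.1 < Rd.+1 + n)%N)).
Proof.
elim: n q u => [q u|n IHn q u /mem_root_pathsS[q' [v [q'n vq' ->]]]].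
  rewrite inE => /eqP -> /[!inE]/eqP ->; rewrite addn0 eqxx /is_node/= ltnSn/=.
  by have := width_gt0 (ltnSn Rd).
have [lq' lE] := root_paths_last q'n.
have [nl _] := IHn _ _ q'n lq'.
have v1 := children_stage vq'.
rewrite last_rcons mem_rcons inE => /predU1P[->|uq'].
  by rewrite eqxx (children_is_node nl vq') v1 lE; split=> //; split=> //; lia.
by have [? [? _]] := IHn _ _ q'n uq'; split=> //; split; lia.
Qed.

Lemma root_paths_uniq n q : q \in root_paths n -> uniq q.
Proof.
elim: n q => [q|n IHn q /mem_root_pathsS[q' [v [q'n vq' ->]]]].
  by rewrite inE => /eqP ->.
rewrite rcons_uniq IHn// andbT; apply/negP => vq.
have [_ [+ _]] := root_paths_nodes q'n vq.
by rewrite (children_stage vq'); have [_ ->] := root_paths_last q'n; lia.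
Qed.

Lemma mem_nodes_upto t u : is_node u -> (u.1 <= t)%N -> u \in nodes_upto Rd t.
Proof.
case: u => s k /andP[/= Rs k2] st; apply/allpairsPdep; exists s, k.
by split => //; rewrite mem_iota; lia.
Qed.

Lemma nodes_upto_uniq t : uniq (nodes_upto Rd t).
Proof.
apply: allpairs_uniq_dep => [|s _|]; try exact: iota_uniq.
by move=> [? ?] [? ?] _ _ /= [-> ->].
Qed.

(** The widths are the successive odd numbers, whose partial sums are squares. *)
Lemma size_nodes_upto t : (Rd < t)%N -> size (nodes_upto Rd t) = ((t - Rd) ^ 2)%N.
Proof.
move=> Rt; rewrite size_allpairs_dep.
elim: (t - Rd)%N => // n IHn.
rewrite -(addn1 n) iotaD map_cat sumn_cat IHn/= size_iota addn0 /width.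
nia.
Qed.

Lemma sum_root_pathsS (V : nmodType) n (F : seq node -> V) :
  \sum_(q <- root_paths n.+1) F q =
  \sum_(q <- root_paths n) \sum_(v <- children Rd (last root q)) F (rcons q v).
Proof. exact: big_allpairs_dep. Qed.

(** Every path with [n] edges ends at exactly one node of stage [t], so grouping by end node runs
    through each path once. *)
Lemma sum_paths_to (V : nmodType) n t (F : nat -> seq node -> V) :
  t = (Rd.+1 + n)%N ->
  \sum_(1 <= k < (width Rd t).+1) \sum_(q <- paths_to Rd t k) F k q =
  \sum_(q <- root_paths n) F (last root q).2 q.
Proof.
move=> tn; rewrite /paths_to (_ : t - Rd.+1 = n)%N; last lia.
under eq_bigr do rewrite big_filter.
under eq_bigr do rewrite big_mkcond/=.
rewrite exchange_big/=; apply: eq_big_seq => q qn.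
have [lq lE] := root_paths_last qn.
have [/andP[_]] := root_paths_nodes qn lq.
rewrite lE -tn; case: (last root q) lE => l1 l2 /= -> l2w _.
rewrite (bigD1_seq l2)/= ?iota_uniq ?mem_index_iota//.
rewrite -tn eqxx big1 ?addr0// => k kl.
by rewrite xpair_eqE eqxx eq_sym (negPf kl).
Qed.

Lemma sum_ord_nth (V : nmodType) (I : Type) (i0 : I) (s : seq I) (F : I -> V) :
  \sum_(j < size s) F (nth i0 s j) = \sum_(i <- s) F i.
Proof. by rewrite (big_nth i0) big_mkord. Qed.

(** The width grows by two per stage, so the index of a middle child lies strictly between 1 and the
    width of its stage. The tests on [k] in [deficit] and [weight] thus identify the incoming
    edge. *)
Lemma uniq_middle_right v : is_node v ->
  (middle_child v != right_child Rd v) * (left_child v != middle_child v)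
  * (left_child v != right_child Rd v).
Proof.
case: v => s k /andP[/= Rs k2]; have W := widthS Rs.
by rewrite !xpair_eqE !eqxx /= W; split; [split|]; apply/eqP; lia.
Qed.

End lattice_paths.

(** * Bounds along a path, the weights as counts of paths, and the cancellation of the boundary
    terms *)

Section lattice_bounds.
Context {Omega : Type} {R : realType}.
Variables (Rd : nat) (D : nat -> Omega -> R) (B : R).
Local Notation root := (Defs.root Rd).
Local Notation root_paths := (root_paths Rd).
Local Notation deficit := (deficit Rd D B).
Local Notation weight := (weight Rd D B).
Local Notation lower := (lower_bound Rd B).
Local Notation upper := (upper_bound Rd B).

Definition edge_lower (x : R) (u v : node) : \bar R :=
  if v == middle_child u then (x - B)%:E
  else if v == right_child Rd u then -oo%E else x%:E.

Definition edge_upper (x : R) (u v : node) : \bar R :=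
  if v == middle_child u then x%:E
  else if v == right_child Rd u then (x - B)%:E else +oo%E.

Lemma notin_child n q (v : node) : q \in root_paths n ->
  (Rd.+1 + n < v.1)%N -> v \notin q.
Proof.
move=> qn nv; apply/negP => vq; have [_ [+ _]] := root_paths_nodes qn vq.
by rewrite leqNgt nv.
Qed.

(** The children of the last node have a stage beyond the path, so both membership tests fail and
    the default branch, a shortage, applies. *)
Lemma bounds_last x n q : q \in root_paths n ->
  lower x q (last root q) = x%:E /\ upper x q (last root q) = +oo%E.
Proof.
move=> qn; have [lq lE] := root_paths_last qn.
rewrite /lower_bound /upper_bound lq/=.
rewrite !(negPf (notin_child qn _))//= lE; lia.
Qed.

Lemma bounds_rcons_last x n q v : q \in root_paths n ->
  v \in children Rd (last root q) ->
  lower x (rcons q v) (last root q) = edge_lower x (last root q) v /\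
  upper x (rcons q v) (last root q) = edge_upper x (last root q) v.
Proof.
move=> qn vq; have [lq lE] := root_paths_last qn.
rewrite /lower_bound /upper_bound !mem_rcons !inE lq orbT/=.
rewrite !(negPf (notin_child qn _))//= ?lE; try lia.
by rewrite !orbF /edge_lower /edge_upper !(eq_sym v).
Qed.

(** Among the nodes of [q], only the last one gets new bounds when the path is extended: the
    children of the others have an earlier stage than [v]. *)
Lemma bounds_rcons x n q u v : q \in root_paths n ->
  v \in children Rd (last root q) -> u \in q -> u != last root q ->
  lower x (rcons q v) u = lower x q u /\ upper x (rcons q v) u = upper x q u.
Proof.
move=> qn vq uq ul; have [_ lE] := root_paths_last qn.
have [_ [_ /(_ ul) un]] := root_paths_nodes qn uq.
have v1 := children_stage vq.
have neq c : c.1 = u.1.+1 -> (c == v) = false.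
  by move=> c1; apply/negP => /eqP cv; move: c1; rewrite cv v1 lE; lia.
by rewrite /lower_bound /upper_bound !mem_rcons !inE uq orbT !neq.
Qed.

Section fixed_outcome.
Variables (x : R) (w : Omega).
Local Notation del u := (deficit x u.1 u.2 w).

Definition in_bounds (q : seq node) (u : node) : bool :=
  (lower x q u < (del u)%:E <= upper x q u)%E.

Definition crosses (u v : node) : bool :=
  (edge_lower x u v < (del u)%:E <= edge_upper x u v)%E.

(* The last node is exempted: its bounds stand for the factor 1{D_t^k > x}, not
   for an edge. *)
Definition follows (q : seq node) : bool :=
  all (fun u => (u == last root q) || in_bounds q u) q.

Lemma follows_rcons n q v : q \in root_paths n ->
  v \in children Rd (last root q) ->
  follows (rcons q v) = follows q && crosses (last root q) v.
Proof.
move=> qn vq; have [lq lE] := root_paths_last qn.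
have vNq : v \notin q by apply: notin_child qn _ => //; rewrite (children_stage vq) lE.
rewrite /follows all_rcons last_rcons eqxx/=.
have [bl bu] := bounds_rcons_last x qn vq.
have crossesE : crosses (last root q) v = in_bounds (rcons q v) (last root q).
  by rewrite /in_bounds bl bu.
apply/allP/andP => [H|[/allP H crl] u uq].
  split; last first.
    have /orP[/eqP lv|] := H _ lq; first by rewrite lv (negPf vNq) in lq.
    by rewrite crossesE.
  apply/allP => u uq; have [//|ul/=] := eqVneq u (last root q).
  have /orP[/eqP uv|] := H _ uq; first by rewrite -uv uq in vNq.
  by rewrite /in_bounds; have [-> ->] := bounds_rcons x qn vq uq ul.
have [ul|ul] := eqVneq u (last root q).
  by rewrite ul -crossesE crl orbT.
have := H _ uq; rewrite (negPf ul)/= /in_bounds.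
by have [-> ->] := bounds_rcons x qn vq uq ul => ->; rewrite orbT.
Qed.

Lemma all_in_bounds n q : q \in root_paths n ->
  all (in_bounds q) q = follows q && (x < del (last root q)).
Proof.
move=> qn; have [lq _] := root_paths_last qn; have [bl bu] := bounds_last x qn.
have inl : in_bounds q (last root q) = (x < del (last root q)).
  by rewrite /in_bounds bl bu lte_fin leey andbT.
apply/allP/andP => [H|[/allP H xl] u uq].
  by split; [apply/allP => u uq; rewrite H ?orbT|rewrite -inl H].
by have /orP[/eqP ->|//] := H _ uq; rewrite inl.
Qed.

Lemma crosses_children u : is_node Rd u ->
  (crosses u (left_child u) = (x < del u)) *
  (crosses u (middle_child u) = (x - B < del u <= x)) *
  (crosses u (right_child Rd u) = (del u <= x - B)).
Proof.
move=> /uniq_middle_right [[mr lm] lr].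
rewrite /crosses /edge_lower /edge_upper !eqxx (negPf lm) (negPf lr).
rewrite (eq_sym (right_child Rd u)) (negPf mr).
by rewrite !lte_fin !lee_fin ltNyr leey andbT.
Qed.

Lemma deficit_children u : is_node Rd u ->
  (del (left_child u) = D u.1.+1 w) *
  (del (middle_child u) = D u.1.+1 w - (x - del u)) *
  (del (right_child Rd u) = D u.1.+1 w - B).
Proof.
case: u => s k nu; have := uniq_middle_right nu.
move: nu => /andP[/= Rs k2]; rewrite !xpair_eqE !eqxx /= leqNgt Rs /=.
move=> [[mr lm] lr]; rewrite (negPf mr).
by rewrite !(eq_sym _ 1%N) (negPf lm) (negPf lr).
Qed.

Lemma weightS t k : (Rd < t)%N -> weight x t.+1 k w =
  if k == 1%N then
    \sum_(1 <= l < (width Rd t).+1) weight x t l w * (x < deficit x t l w)%R%:R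
  else if k == width Rd t.+1 then
    \sum_(1 <= l < (width Rd t).+1)
      weight x t l w * (deficit x t l w <= x - B)%R%:R
  else weight x t k.-1 w * (x - B < deficit x t k.-1 w <= x)%R%:R.
Proof. by move=> Rt /=; rewrite leqNgt Rt. Qed.

(** Serves the induction in [weight_paths]: the hypothesis is the induction hypothesis, and [g] will
    be the indicator of the condition for a left or a right edge. *)
Lemma sum_weight n (g : nat -> R) :
  (forall k, (1 <= k <= width Rd (Rd.+1 + n))%N ->
    weight x (Rd.+1 + n) k w =
      \sum_(q <- paths_to Rd (Rd.+1 + n) k) (follows q)%:R) ->
  \sum_(1 <= k < (width Rd (Rd.+1 + n)).+1) weight x (Rd.+1 + n) k w * g k =
  \sum_(q <- root_paths n) (follows q)%:R * g (last root q).2.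
Proof.
move=> wE; rewrite -(sum_paths_to (fun k q => (follows q)%:R * g k) erefl).
rewrite big_nat_cond [RHS]big_nat_cond; apply: eq_bigr => k; rewrite andbT ltnS => kw.
by rewrite wE// big_distrl.
Qed.

(** Both sides obey the same recursion over the last edge: the weight by definition, and the number
    of followed paths by [follows_rcons]. *)
Lemma weight_paths n k : (1 <= k <= width Rd (Rd.+1 + n))%N ->
  weight x (Rd.+1 + n) k w =
    \sum_(q <- paths_to Rd (Rd.+1 + n) k) (follows q)%:R.
Proof.
elim: n k => [k|n IHn k].
  rewrite addn0 /width => k1; have -> : k = 1%N by lia.
  rewrite /paths_to subnn/= eqxx big_seq1 leqnn /follows/= eqxx//.
have Rt : (Rd < Rd.+1 + n)%N by lia.
have W := widthS Rt; have W0 := width_gt0 Rt.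
rewrite addnS => kw.
(* Splits off the last edge. The extension of [q] that ends at index [k] is the left one if [k] is
   1, the right one if [k] is the width, and otherwise the middle one, provided that [q] ends at
   index [k - 1]. *)
have -> : \sum_(q <- paths_to Rd (Rd.+1 + n).+1 k) (follows q)%:R =
    \sum_(q <- root_paths n) (follows q)%:R *
      (if k == 1%N then x < del (last root q) else
       if k == width Rd (Rd.+1 + n).+1 then del (last root q) <= x - B else
       (k == (last root q).2.+1) && (x - B < del (last root q) <= x))%R%:R :> R.
  rewrite /paths_to (_ : (Rd.+1 + n).+1 - Rd.+1 = n.+1)%N; last lia.
  rewrite big_filter big_mkcond sum_root_pathsS/=; apply: eq_big_seq => q qn.
  have [lq lE] := root_paths_last qn.
  have [nl _] := root_paths_nodes qn lq.
  have [[mr lm] lr] := uniq_middle_right nl.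
  rewrite /children !big_cons big_nil addr0 !last_rcons.
  rewrite !(follows_rcons qn) ?inE ?eqxx ?orbT// !crosses_children//.
  move: nl mr lm lr => /andP[_]; case: (last root q) lE => l1 l2 /= ->.
  rewrite !xpair_eqE !eqxx /= => l2w mr lm lr.
  rewrite !(eq_sym k); have [k1|_] := eqVneq 1%N k.
    rewrite -k1 !(eq_sym _ 1%N) (negPf lm) (negPf lr) !addr0.
    by case: (follows q); rewrite ?mul1r ?mul0r.
  rewrite add0r; have [kK|_] := eqVneq (width Rd (Rd.+1 + n).+1) k.
    rewrite -kK (negPf mr) add0r.
    by case: (follows q); rewrite ?mul1r ?mul0r.
  rewrite addr0; case: (l2.+1 == k); case: (follows q); rewrite ?mul1r ?mul0r ?andbF//.
rewrite weightS//; case: eqP => [_|k1].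
  by rewrite (sum_weight (fun k => (x < deficit x (Rd.+1 + n) k w)%R%:R))//;
     apply: eq_big_seq => q /root_paths_last[_ <-].
case: eqP => [_|kK].
  by rewrite (sum_weight (fun k => (deficit x (Rd.+1 + n) k w <= x - B)%R%:R))//;
     apply: eq_big_seq => q /root_paths_last[_ <-].
rewrite IHn; last lia.
rewrite /paths_to (_ : Rd.+1 + n - Rd.+1 = n)%N; last lia.
rewrite big_filter big_distrl big_mkcond/=; apply: eq_big_seq => q /root_paths_last[_].
case: (last root q) => l1 l2 /= ->; rewrite xpair_eqE eqxx/=.
rewrite (_ : (k == l2.+1) = (l2 == k.-1)); last lia.
by case: eqP => [->|_] /=; rewrite ?mulr0.
Qed.

(** The bracket in the boundary terms of the subgradient: the derivatives of the bounds, counted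
    only where the deficit meets them. *)
Definition boundary (q : seq node) (u : node) : R :=
  derive1 (fun y : R => fine (upper y q u)) x * ((del u)%:E == upper x q u)%:R -
  derive1 (fun y : R => fine (lower y q u)) x * ((del u)%:E == lower x q u)%:R.

Definition edge_boundary (u v : node) : R :=
  derive1 (fun y : R => fine (edge_upper y u v)) x *
    ((del u)%:E == edge_upper x u v)%:R -
  derive1 (fun y : R => fine (edge_lower y u v)) x *
    ((del u)%:E == edge_lower x u v)%:R.

Lemma derive1_subr (a : R) : derive1 (fun y : R => y - a) x = 1.
Proof. by rewrite derive1E deriveB// derive_id derive_cst subr0. Qed.

(** A threshold between two neighbouring children is an upper bound for one and a lower bound for
    the other, hence occurs with opposite signs. *)
Lemma edge_boundary_children u : is_node Rd u ->
  (edge_boundary u (left_child u) = - (del u == x)%:R) *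
  (edge_boundary u (middle_child u) = (del u == x)%:R - (del u == x - B)%:R) *
  (edge_boundary u (right_child Rd u) = (del u == x - B)%:R).
Proof.
move=> /uniq_middle_right [[mr lm] lr].
rewrite /edge_boundary /edge_upper /edge_lower !eqxx (negPf lm) (negPf lr).
rewrite (eq_sym (right_child Rd u)) (negPf mr) /=.
by rewrite !derive1_subr !derive1_id !derive1_cst !eqe !mul1r !mul0r sub0r subr0.
Qed.

Lemma boundary_notin q u : u \notin q -> boundary q u = 0.
Proof.
move=> uq; rewrite /boundary /upper_bound /lower_bound uq/=.
by rewrite !derive1_cst !mul0r subr0.
Qed.

Lemma boundary_last n q : q \in root_paths n ->
  boundary q (last root q) = - (del (last root q) == x)%:R.
Proof.
move=> qn; rewrite /boundary.
have -> : (fun y => fine (upper y q (last root q))) = cst 0.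
  by apply/funext => y; rewrite (bounds_last _ qn).2.
have -> : (fun y => fine (lower y q (last root q))) = id.
  by apply/funext => y; rewrite (bounds_last _ qn).1.
rewrite (bounds_last _ qn).1 (bounds_last _ qn).2.
by rewrite derive1_id derive1_cst mul0r mul1r sub0r.
Qed.

Lemma boundary_rcons n q u v : q \in root_paths n ->
  v \in children Rd (last root q) -> u \in q -> u != last root q ->
  boundary (rcons q v) u = boundary q u.
Proof.
move=> qn vq uq ul; rewrite /boundary.
have -> : (fun y => fine (upper y (rcons q v) u)) = fun y => fine (upper y q u).
  by apply/funext => y; rewrite (bounds_rcons _ qn vq uq ul).2.
have -> : (fun y => fine (lower y (rcons q v) u)) = fun y => fine (lower y q u).
  by apply/funext => y; rewrite (bounds_rcons _ qn vq uq ul).1.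
by rewrite (bounds_rcons _ qn vq uq ul).1 (bounds_rcons _ qn vq uq ul).2.
Qed.

Lemma boundary_rcons_last n q v : q \in root_paths n ->
  v \in children Rd (last root q) ->
  boundary (rcons q v) (last root q) = edge_boundary (last root q) v.
Proof.
move=> qn vq; rewrite /boundary.
have -> : (fun y => fine (upper y (rcons q v) (last root q))) =
    fun y => fine (edge_upper y (last root q) v).
  by apply/funext => y; rewrite (bounds_rcons_last _ qn vq).2.
have -> : (fun y => fine (lower y (rcons q v) (last root q))) =
    fun y => fine (edge_lower y (last root q) v).
  by apply/funext => y; rewrite (bounds_rcons_last _ qn vq).1.
by rewrite (bounds_rcons_last _ qn vq).1 (bounds_rcons_last _ qn vq).2.
Qed.

(** The path form of the condition on the remaining entries $(\mathbf{D}_t)_{-i}$, where [u] is the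
    node whose bound is attained; the last node is still exempted. *)
Definition follows_except (u : node) (q : seq node) : bool :=
  all (fun v => [|| v == u, v == last root q | in_bounds q v]) q.

Definition boundary_sum (q : seq node) : R :=
  \sum_(u <- q | u != last root q) boundary q u * (follows_except u q)%:R.

Lemma follows_except_last q : follows_except (last root q) q = follows q.
Proof. by apply: eq_all => u; rewrite orbA orbb. Qed.

Lemma follows_except_rcons n q u v : q \in root_paths n ->
  v \in children Rd (last root q) -> u \in q ->
  follows_except u (rcons q v) =
  follows_except u q && ((last root q == u) || crosses (last root q) v).
Proof.
move=> qn vq uq; have [lq lE] := root_paths_last qn.
have vNq : v \notin q by apply: notin_child qn _ => //; rewrite (children_stage vq) lE.
have neq z : z \in q -> (z == v) = false.
  by move=> zq; apply/negP => /eqP zv; rewrite -zv zq in vNq.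
rewrite /follows_except all_rcons last_rcons eqxx orbT/=.
have [bl bu] := bounds_rcons_last x qn vq.
have crossesE : crosses (last root q) v = in_bounds (rcons q v) (last root q).
  by rewrite /in_bounds bl bu.
have inE' z : z \in q -> z != last root q ->
    in_bounds (rcons q v) z = in_bounds q z.
  by move=> zq zl; rewrite /in_bounds; have [-> ->] := bounds_rcons x qn vq zq zl.
apply/allP/andP => [H|[/allP H crl] z zq].
  split; last by have := H _ lq; rewrite neq// crossesE.
  apply/allP => z zq; have [//|zl/=] := eqVneq z (last root q); first by rewrite orbT.
  by have := H _ zq; rewrite neq//= inE'.
have [zl|zl] := eqVneq z (last root q).
  by move: crl; rewrite zl crossesE => /orP[->//|->]; rewrite !orbT.
by have := H _ zq; rewrite (negPf zl)/= inE'// => /orP[->//|->]; rewrite !orbT.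
Qed.

(** A product rule: either the attained bound is at an earlier node and the new edge is crossed, or
    it is on the new edge and the path before it is followed. *)
Lemma boundary_sum_rcons n q v : q \in root_paths n ->
  v \in children Rd (last root q) ->
  boundary_sum (rcons q v) = boundary_sum q * (crosses (last root q) v)%:R +
    edge_boundary (last root q) v * (follows q)%:R.
Proof.
move=> qn vq; have [lq lE] := root_paths_last qn.
have vNq : v \notin q by apply: notin_child qn _ => //; rewrite (children_stage vq) lE.
have neq z : z \in q -> z != v.
  by move=> zq; apply/negP => /eqP zv; rewrite -zv zq in vNq.
rewrite /boundary_sum -cats1 big_cat /= big_cons big_nil cats1 last_rcons eqxx addr0.
rewrite big_seq_cond (eq_bigl (mem q)); last first.
  by move=> u /=; case: (boolP (u \in q)) => // /neq ->.
rewrite -big_seq (bigD1_seq (last root q))//= ?(root_paths_uniq qn)//.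
rewrite (boundary_rcons_last qn vq) (follows_except_rcons qn vq lq) eqxx andbT.
rewrite follows_except_last addrC; congr (_ + _).
rewrite big_distrl big_seq_cond [RHS]big_seq_cond; apply: eq_bigr => u /andP[uq ul] /=.
rewrite (boundary_rcons qn vq uq ul) (follows_except_rcons qn vq uq).
by rewrite eq_sym (negPf ul)/= -mulrA -natrM mulnb.
Qed.

(* The two sides of every threshold cancel out: at [del u = x] the left and the
   middle child of [u] have the same deficit, at [del u = x - B] so do the
   middle and the right one. *)
Lemma sum_boundary_sum n (phi : R -> R) :
  \sum_(q <- root_paths n) boundary_sum q * phi (del (last root q)) = 0.
Proof.
elim: n phi => [|n IHn] phi.
  by rewrite big_seq1 /boundary_sum big_cons big_nil eqxx mul0r.
rewrite sum_root_pathsS.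
pose Dn := D (Rd.+1 + n).+1 w.
(* The total contribution of the children of a node with deficit [z]. It depends on the node only
   through [z], so the induction hypothesis applies to it; this is why [phi] is arbitrary. *)
pose psi (z : R) : R := (x < z)%R%:R * phi Dn +
  (x - B < z <= x)%R%:R * phi (Dn - (x - z)) + (z <= x - B)%R%:R * phi (Dn - B).
rewrite -[RHS](IHn psi); apply: eq_big_seq => q qn.
have [lq lE] := root_paths_last qn; have [nl _] := root_paths_nodes qn lq.
rewrite /children !big_cons big_nil addr0 !last_rcons.
rewrite !(boundary_sum_rcons qn) ?inE ?eqxx ?orbT// !crosses_children//.
rewrite !edge_boundary_children// !deficit_children// lE -/Dn /psi.
set f := (follows q)%:R; set z := deficit _ _ _ _.
have e1 : (z == x)%:R * phi (Dn - (x - z)) = (z == x)%:R * phi Dn.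
  by case: eqP => [->|_]; rewrite ?mul0r// subrr subr0.
have e2 : (z == x - B)%:R * phi (Dn - (x - z)) = (z == x - B)%:R * phi (Dn - B).
  by case: eqP => [->|_]; rewrite ?mul0r//; congr (_ * phi _); ring.
move: e1 e2; set a := phi (Dn - (x - z)); set b := phi Dn; set c := phi (Dn - B).
set i := (z == x)%:R; set j := (z == x - B)%:R => e1 e2.
transitivity (boundary_sum q * ((x < z)%R%:R * b + (x - B < z <= x)%R%:R * a
    + (z <= x - B)%R%:R * c) + f * ((i * a - i * b) - (j * a - j * c))); first by ring.
by rewrite e1 e2 !subrr mulr0 addr0.
Qed.

(** Nodes off the path have infinite bounds and contribute nothing. For any other node than the
    last, the condition at the last node remains in force and gives the factor for a shortage. *)
Lemma sum_boundary_path n t q : t = (Rd.+1 + n)%N -> q \in root_paths n ->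
  \sum_(u <- nodes_upto Rd t) (del (last root q) - x) * boundary q u *
    (all (fun v => (v == u) || in_bounds q v) q)%:R =
  boundary_sum q * ((del (last root q) - x) * (x < del (last root q))%R%:R).
Proof.
move=> tn qn; have [lq lE] := root_paths_last qn; set z := del _.
have [bl bu] := bounds_last x qn.
have inl : in_bounds q (last root q) = (x < z) by rewrite /in_bounds bl bu lte_fin leey andbT.
have -> : \sum_(u <- nodes_upto Rd t) (z - x) * boundary q u *
    (all (fun v => (v == u) || in_bounds q v) q)%:R =
    \sum_(u <- q) (z - x) * boundary q u *
    (all (fun v => (v == u) || in_bounds q v) q)%:R.
  rewrite (bigID (mem q))/= [X in _ + X]big1 ?addr0; last first.
    by move=> u /boundary_notin ->; rewrite mulr0 mul0r.
  rewrite -big_filter; apply: perm_big; apply: uniq_perm.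
  - exact/filter_uniq/nodes_upto_uniq.
  - exact: root_paths_uniq qn.
  - move=> u; rewrite mem_filter andb_idr// => uq.
    have [nu [un _]] := root_paths_nodes qn uq.
    by apply: mem_nodes_upto => //; rewrite tn.
rewrite (bigD1_seq (last root q))//= ?(root_paths_uniq qn)//.
rewrite (boundary_last qn) -/z.
(* At the last node the attained bound is [x], where the prefactor vanishes. *)
have -> : (z - x) * - (z == x)%:R = 0.
  by case: eqP => [->|_]; rewrite ?subrr ?mul0r// oppr0 mulr0.
rewrite mul0r add0r /boundary_sum big_distrl/=.
rewrite big_seq_cond [RHS]big_seq_cond; apply: eq_bigr => u /andP[uq ul].
have -> : all (fun v => (v == u) || in_bounds q v) q = follows_except u q && (x < z).
  rewrite -inl; apply/allP/andP => [H|[/allP H zl] v vq].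
    split; last by have := H _ lq; rewrite eq_sym (negPf ul).
    by apply/allP => v vq; have /orP[->//|->] := H _ vq; rewrite !orbT.
  by have /or3P[->//|/eqP ->|->] := H _ vq; rewrite ?zl orbT.
by rewrite -mulnb natrM; ring.
Qed.

End fixed_outcome.

End lattice_bounds.

(** * From paths to the columns of the matrices of bounds *)

Section lattice_boxes.
Context {Omega : Type} {R : realType}.
Variables (Rd : nat) (D : nat -> Omega -> R) (B x : R) (w : Omega).
Local Notation root := (Defs.root Rd).
Local Notation deficit := (deficit Rd D B).
Local Notation weight := (weight Rd D B).

Lemma mem_paths_to t k (j : 'I_(size (paths_to Rd t k))) :
  let q := nth [::] (paths_to Rd t k) j in
  q \in root_paths Rd (t - Rd.+1) /\ last root q = (t, k).
Proof.
by have := mem_nth [::] (ltn_ord j); rewrite {2}/paths_to mem_filter => /andP[/eqP].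
Qed.

Lemma in_bounds_notin q u : u \notin q -> in_bounds Rd D B x w q u.
Proof. by move=> uq; rewrite /in_bounds /lower_bound /upper_bound uq/= ltNyr leey. Qed.

Section boxes.
Variables (t k : nat) (j : 'I_(size (paths_to Rd t k))).
Hypothesis Rt : (Rd < t)%N.
Local Notation q := (nth [::] (paths_to Rd t k) j).
Local Notation nodes := (nodes_upto Rd t).

Let nodes_index u : u \in q ->
  exists i : 'I_((t - Rd) ^ 2), nth root nodes i = u.
Proof.
move=> uq; have [qn _] := mem_paths_to j; have [nu [ut _]] := root_paths_nodes qn uq.
have un : u \in nodes by apply: mem_nodes_upto nu _; apply: leq_trans ut _; lia.
have it : (index u nodes < (t - Rd) ^ 2)%N by rewrite -size_nodes_upto ?index_mem.
by exists (Ordinal it); rewrite /= nth_index.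
Qed.

(** Entries off the path have infinite bounds and hold trivially, so the condition on the whole
    vector reduces to the nodes of the path. *)
Lemma in_boxE : in_box D B x j w = all (in_bounds Rd D B x w q) q.
Proof.
apply/forallP/allP => [H u /nodes_index[i <-]|H i].
  by have := H i; rewrite !mxE.
rewrite !mxE; have [uq|/in_bounds_notin//] := boolP (nth root nodes i \in q).
exact: H.
Qed.

Lemma in_box_exceptE (i : 'I_((t - Rd) ^ 2)) :
  in_box_except D B x i j w =
  all (fun v => (v == nth root nodes i) || in_bounds Rd D B x w q v) q.
Proof.
have inn (i' : 'I_((t - Rd) ^ 2)) : (i' < size nodes)%N by rewrite size_nodes_upto.
apply/forallP/allP => [H u /nodes_index[i' <-]|H i'].
  rewrite nth_uniq ?nodes_upto_uniq//; have [//|ii'/=] := eqVneq (i' : nat) i.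
  by have /implyP/(_ ii') := H i'; rewrite !mxE.
apply/implyP => ii'; rewrite !mxE.
have [uq|/in_bounds_notin//] := boolP (nth root nodes i' \in q).
have := H _ uq; rewrite nth_uniq ?nodes_upto_uniq//.
by rewrite (negPf (ii' : (i' : nat) != i)).
Qed.

Lemma boundaryE (i : 'I_((t - Rd) ^ 2)) :
  dupper B x i j *
    ((deficit_vector Rd D B x t w i 0)%:E == upper_mx Rd B x t k i j)%:R -
  dlower B x i j *
    ((deficit_vector Rd D B x t w i 0)%:E == lower_mx Rd B x t k i j)%:R =
  boundary Rd D B x w q (nth root nodes i).
Proof.
rewrite /dupper /dlower.
have -> : (fun y => fine (upper_mx Rd B y t k i j)) =
    fun y => fine (upper_bound Rd B y q (nth root nodes i)).
  by apply/funext => y; rewrite mxE.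
have -> : (fun y => fine (lower_mx Rd B y t k i j)) =
    fun y => fine (lower_bound Rd B y q (nth root nodes i)).
  by apply/funext => y; rewrite mxE.
by rewrite !mxE.
Qed.

End boxes.

Lemma sum_in_box t k : (Rd < t)%N -> (1 <= k <= width Rd t)%N ->
  (x < deficit x t k w)%R%:R * weight x t k w =
    \sum_(j < size (paths_to Rd t k)) (in_box D B x j w)%:R.
Proof.
move=> Rt kt; have tn : t = (Rd.+1 + (t - Rd.+1))%N by lia.
rewrite {2}tn weight_paths -?tn// big_distrr/=.
rewrite -(sum_ord_nth [::]); apply: eq_bigr => j _.
have [qn lq] := mem_paths_to j.
by rewrite (in_boxE j Rt) (all_in_bounds _ _ _ _ qn) lq/= -natrM mulnb andbC.
Qed.

(** Rewritten over paths, this is [sum_boundary_sum] with [phi] the positive part of [z - x]: the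
    cancellation holds for every outcome. *)
Lemma sum_boundary_box t : (Rd < t)%N ->
  \sum_(1 <= k < (width Rd t).+1) \sum_(j < size (paths_to Rd t k))
    \sum_(i < (t - Rd) ^ 2) (deficit x t k w - x) *
      (dupper B x i j *
         ((deficit_vector Rd D B x t w i 0)%:E == upper_mx Rd B x t k i j)%:R -
       dlower B x i j *
         ((deficit_vector Rd D B x t w i 0)%:E == lower_mx Rd B x t k i j)%:R) *
      (in_box_except D B x i j w)%:R = 0.
Proof.
move=> Rt; have tn : t = (Rd.+1 + (t - Rd.+1))%N by lia.
pose phi z : R := (z - x) * (x < z)%R%:R.
rewrite -[RHS](sum_boundary_sum Rd D B x w (t - Rd.+1) phi).
rewrite -(sum_paths_to (fun _ q => boundary_sum Rd D B x w q *
  phi (deficit x (last root q).1 (last root q).2 w)) tn).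
apply: eq_bigr => k _; rewrite -(sum_ord_nth [::]); apply: eq_bigr => j _.
have [qn lq] := mem_paths_to j.
rewrite -(sum_boundary_path _ _ _ _ tn qn) lq/=.
rewrite [RHS](big_nth root) big_mkord (size_nodes_upto Rt).
apply: eq_bigr => i _; rewrite boundaryE in_box_exceptE//.
Qed.

(** The deficit at the end of the path is [D] at that stage minus what the last edge puts into
    storage, and this energy is nonnegative even when the attained bound belongs to that edge. *)
Lemma boundary_deficit n q u : 0 <= B -> q \in root_paths Rd n ->
  boundary Rd D B x w q u != 0 ->
  all (fun v => (v == u) || in_bounds Rd D B x w q v) q ->
  let z := deficit x (last root q).1 (last root q).2 w in
  z = x \/ x < z <= D (Rd.+1 + n)%N w.
Proof.
move=> hB qn bu /allP H z; have [lq lE] := root_paths_last qn.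
have [ul|ul] := eqVneq u (last root q).
  left; move: bu; rewrite ul (boundary_last _ _ _ _ qn) -/z oppr_eq0 pnatr_eq0.
  by case: (z =P x).
have uq : u \in q by apply: contraNT bu => /(boundary_notin Rd D B x w) ->.
right; apply/andP; split.
  have := H _ lq; rewrite eq_sym (negPf ul)/= /in_bounds.
  by have [-> ->] := bounds_last B x qn; rewrite lte_fin leey andbT.
case: n qn lE => [|n] qn lE.
  by move: qn uq ul; rewrite inE => /eqP -> /[!inE]/eqP ->; rewrite eqxx.
have [q' [v [q'n vq' qE]]] := mem_root_pathsS qn.
have [lq' lE'] := root_paths_last q'n; have [nl _] := root_paths_nodes q'n lq'.
(* Crossing a middle edge needs a deficit of at most [x]. If [u] is the node being left, the
   attained bound is [x] or [x - B], with the same conclusion. *)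
have l'x : v = middle_child (last root q') ->
    deficit x (last root q').1 (last root q').2 w <= x.
  move=> vm; have [lu|lu] := eqVneq u (last root q').
    move: bu; rewrite qE lu (boundary_rcons_last _ _ _ _ q'n vq') vm.
    rewrite edge_boundary_children//; set dl := deficit x _ _ w.
    have [->//|_] := eqVneq dl x; have [->|_] := eqVneq dl (x - B).
      by rewrite lerBlDr lerDl.
    by rewrite subrr eqxx.
  have := H (last root q'); rewrite qE mem_rcons inE lq' orbT => /(_ isT).
  rewrite eq_sym (negPf lu)/= /in_bounds.
  have [-> ->] := bounds_rcons_last B x q'n vq'.
  have := crosses_children D B x w nl; rewrite /crosses vm => -[[_ ->] _].
  by case/andP.
rewrite {}/z qE last_rcons addnS -lE'.
have := vq'; rewrite !inE => /or3P[] /eqP vE; rewrite vE deficit_children//.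
- by have := l'x vE; lra.
- by rewrite lerBlDr lerDl.
Qed.

(** Provides an integrable dominating function when only the positive part of [D t] is integrable;
    the derivatives of the bounds do not depend on the outcome. *)
Lemma boundary_box_bound t k (j : 'I_(size (paths_to Rd t k)))
    (i : 'I_((t - Rd) ^ 2)) : 0 <= B -> (Rd < t)%N ->
  `|(deficit x t k w - x) *
    (dupper B x i j *
       ((deficit_vector Rd D B x t w i 0)%:E == upper_mx Rd B x t k i j)%:R -
     dlower B x i j *
       ((deficit_vector Rd D B x t w i 0)%:E == lower_mx Rd B x t k i j)%:R) *
    (in_box_except D B x i j w)%:R| <=
  (Num.max (D t w) 0 + `|x|) * (`|dupper B x i j| + `|dlower B x i j|).
Proof.
move=> hB Rt; have tn : t = (Rd.+1 + (t - Rd.+1))%N by lia.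
have M0 : 0 <= Num.max (D t w) 0 + `|x| by rewrite addr_ge0// le_max lexx orbT.
have C0 : 0 <= `|dupper B x i j| + `|dlower B x i j| by rewrite addr_ge0.
rewrite in_box_exceptE//; case: (boolP (all _ _)) => [Hall|_]; last first.
  by rewrite mulr0 normr0 mulr_ge0.
rewrite mulr1; set bd := (X in _ * X).
have bdC : `|bd| <= `|dupper B x i j| + `|dlower B x i j|.
  rewrite /bd; apply: (le_trans (ler_normB _ _)); rewrite !normrM.
  by apply: lerD; rewrite ler_piMr// ger0_norm// lern1 leq_b1.
have [->|bd0] := eqVneq bd 0; first by rewrite mulr0 normr0 mulr_ge0.
rewrite normrM ler_pM//.
move: bd0; rewrite /bd boundaryE => bd0.
have [qn lq] := mem_paths_to j.
have := boundary_deficit hB qn bd0 Hall; rewrite -tn lq => -[|].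
  by move=> ->; rewrite subrr normr0.
have := ler_norm x; have := ler_norm (- x); rewrite normrN.
move=> nx px /andP[xz zD]; rewrite ger0_norm ?subr_ge0 ?(ltW xz)//.
have : D t w <= Num.max (D t w) 0 by rewrite le_max lexx.
by lra.
Qed.

End lattice_boxes.

(** * The greedy policy *)

Section greedy_policy.
Context {R : realType}.
Variables (d : nat -> R) (B x : R).
Hypothesis hB : 0 <= B.

(** Stages are counted from 0, and [level n] is the energy stored just before stage [n]: the balance
    of the previous stage clipped to the capacity. *)
Fixpoint level (n : nat) : R :=
  if n is m.+1 then Num.min B (Num.max 0 (level m + x - d m)) else 0.

(** The deficit left when the storage is drawn down entirely, before the supply is counted; it is
    the deficit at the lattice node reached. *)
Definition residual (n : nat) : R := d n - level n.

Lemma level_bounds n : 0 <= level n <= B.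
Proof.
by case: n => [|n] /=; rewrite ?lexx// le_min hB le_max lexx/= ge_min lexx.
Qed.

Lemma level_shortage n : x < residual n -> level n.+1 = 0.
Proof.
rewrite /residual /= => xg.
have -> : Num.max 0 (level n + x - d n) = 0 by apply/max_idPl; lra.
exact/min_idPr.
Qed.

Lemma level_surplus n : x - B < residual n <= x -> level n.+1 = x - residual n.
Proof.
rewrite /residual /= => /andP[gB gx].
rewrite (_ : Num.max _ _ = level n + x - d n); last by apply/max_idPr; lra.
by rewrite (min_idPr _); lra.
Qed.

Lemma level_full n : residual n <= x - B -> level n.+1 = B.
Proof.
have := hB; rewrite /residual /= => B0 xg.
rewrite (_ : Num.max _ _ = level n + x - d n); last by apply/max_idPr; lra.
by apply/min_idPl; lra.
Qed.

(* The decrease of the remaining cost of the policy per unit of energy added to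
   the storage at stage [n], with [N] stages to go. *)
Fixpoint marginal (N n : nat) : R :=
  if N is N'.+1 then
    if x < residual n then 1 else if x - B < residual n then marginal N' n.+1 else 0
  else 0.

Lemma marginal_bounds N n : 0 <= marginal N n <= 1.
Proof.
elim: N n => [|N IHN] n /=; first by rewrite lexx ler01.
by case: ifP => _; [rewrite ler01 lexx|case: ifP => // _; rewrite lexx ler01].
Qed.

Variable nu : nat -> R.
Hypothesis nu0 : nu 0 = 1.
Hypothesis nuS : forall n,
  nu n.+1 = if x - B < residual n <= x then nu n + 1 else 1.

(** Induction on the number [N] of stages to go, with [marginal] as dual multiplier. The factor of
    [y - x] is the sum of the marginals of these stages: a shortage counts the length [nu] of the
    run that it ends, and [(nu n - 1) * marginal N n] removes the part of the current run before
    stage [n]. *)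
Lemma greedy_subgradient_from (b : nat -> R) (y : R) N n :
  (forall i, 0 <= b i <= B) ->
  \sum_(i < N) Num.max (residual (n + i) - x) 0 - marginal N n * (b n - level n) -
    (y - x) * (\sum_(i < N) (x < residual (n + i))%R%:R * nu (n + i) -
               (nu n - 1) * marginal N n) <=
  \sum_(i < N) Num.max (d (n + i) - y + (b (n + i).+1 - b (n + i))) 0.
Proof.
move=> b_bounds; elim: N n => [n|N IHN n].
  by rewrite !big_ord0 /= mulr0 mul0r subrr mulr0 subr0.
have shift F : \sum_(i < N.+1) F (n + i)%N = F n + \sum_(i < N) F (n.+1 + i)%N :> R.
  by rewrite big_ord_recl addn0; congr (_ + _); apply: eq_bigr => i _; rewrite addSnnS.
rewrite (shift (fun i => Num.max (residual i - x) 0)).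
rewrite (shift (fun i => (x < residual i)%R%:R * nu i)).
rewrite (shift (fun i => Num.max (d i - y + (b i.+1 - b i)) 0)).
have := IHN n.+1; have := nuS n; have /andP[] := marginal_bounds N n.+1.
have /andP[] := b_bounds n.+1; have /andP[] := b_bounds n.
set S1 := \sum_(i < N) _; set S2 := \sum_(i < N) _; set S3 := \sum_(i < N) _.
set m := marginal N n.+1; set v := d n - y + (b n.+1 - b n) => bn0 bnB bSn0 bSnB m0 m1 nuSn IH.
have v0 : 0 <= Num.max v 0 by rewrite le_max lexx orbT.
have vv : v <= Num.max v 0 by rewrite le_max lexx.
rewrite /=; have [xg|gx] := ltP x (residual n).
  move: IH nuSn; rewrite (level_shortage xg) (leNgt (residual n)) xg andbF => IH nuSn.
  rewrite (max_idPl _); last by rewrite subr_ge0 ltW.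
  move: IH; rewrite nuSn mul1r mulr1 /residual => IH.
  have mb : m * b n.+1 <= b n.+1 by rewrite ler_piMl//; lra.
  by rewrite mul1r; move: vv IH mb; rewrite {1}/v; lra.
have gx0 : residual n - x <= 0 by lra.
rewrite (max_idPr _)// mul0r add0r add0r.
have [xBg|gxB] := ltP (x - B) (residual n).
  have xg : x - B < residual n <= x by rewrite xBg gx.
  move: IH nuSn; rewrite (level_surplus xg) xg => IH nuSn.
  (* Weak duality at a single stage: a multiplier between 0 and 1 times the net shortfall is at most
     its positive part. *)
  have mv : m * v <= Num.max v 0.
    by apply: le_trans (ler_wpM2l _ vv) _; [lra|rewrite ler_piMl//; lra].
  move: mv IH; rewrite nuSn {1}/v /residual.
  rewrite -/m; lra.
move: IH nuSn; rewrite (level_full gxB) ltNge gxB/= => IH nuSn.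
move: IH; rewrite nuSn mul0r mulr0 subr0.
have mb : m * (b n.+1 - B) <= 0 by rewrite mulr_ge0_le0//; lra.
lra.
Qed.

Lemma greedy_subgradient (b : nat -> R) (y : R) N :
  b 0 = 0 -> (forall i, 0 <= b i <= B) ->
  \sum_(i < N) Num.max (residual i - x) 0 -
    (y - x) * \sum_(i < N) (x < residual i)%R%:R * nu i <=
  \sum_(i < N) Num.max (d i - y + (b i.+1 - b i)) 0.
Proof.
move=> b0 bB; have := greedy_subgradient_from y N 0 bB.
by rewrite b0 subrr nu0 subrr mul0r mulr0 !subr0.
Qed.

(** In a shortage the storage ends up empty; otherwise the deficit is covered and both sides
    vanish. *)
Lemma greedy_cost n :
  Num.max (d n - x + (level n.+1 - level n)) 0 = Num.max (residual n - x) 0.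
Proof.
have B0 := hB; have [xg|gx] := ltP x (residual n).
  by rewrite level_shortage// /residual; congr Num.max; ring.
rewrite [RHS]max_r ?subr_le0//; apply/max_idPr.
have [xBg|gxB] := ltP (x - B) (residual n).
  by rewrite level_surplus ?xBg// /residual; lra.
by rewrite level_full//; move: gxB; rewrite /residual; lra.
Qed.

End greedy_policy.

Lemma sum_stages (V : nmodType) (Rd T : nat) (F : nat -> V) :
  \sum_(Rd.+1 <= t < (Rd + T).+1) F t = \sum_(i < T) F (Rd.+1 + i)%N.
Proof.
rewrite -{1}[Rd.+1]add0n big_addn big_mkord (_ : (Rd + T).+1 - Rd.+1 = T)%N; last lia.
by apply: eq_bigr => i _; rewrite addnC.
Qed.

(** * The lattice as a record of the greedy policy *)

Section greedy_lattice.
Context {Omega : Type} {R : realType}.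
Variables (Rd T : nat) (D : nat -> Omega -> R) (B : R).
Local Notation deficit := (deficit Rd D B).
Local Notation weight := (weight Rd D B).

Definition lattice_cost (x : R) (w : Omega) : R :=
  \sum_(Rd.+1 <= t < (Rd + T).+1) \sum_(1 <= k < (width Rd t).+1)
    Num.max (deficit x t k w - x) 0 * weight x t k w.

(** Minus a subgradient of [lattice_cost] in the supply per stage, outcome by outcome; the boundary
    terms, whose sum is zero, are left out. *)
Definition lattice_slope (x : R) (w : Omega) : R :=
  \sum_(Rd.+1 <= t < (Rd + T).+1) \sum_(1 <= k < (width Rd t).+1)
    \sum_(j < size (paths_to Rd t k))
      (minn k (width Rd t + 1 - k))%:R * (in_box D B x j w)%:R.

Definition deficits (w : Omega) (n : nat) : R := D (Rd.+1 + n)%N w.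

Section fixed_outcome.
Variables (x : R) (w : Omega).
Local Notation gap := (residual (deficits w) B x).

(** The index, within its stage, of the only node of weight 1. *)
Fixpoint active (n : nat) : nat :=
  if n is m.+1 then
    if x < gap m then 1%N
    else if x - B < gap m then (active m).+1 else width Rd (Rd.+1 + n)
  else 1%N.

Let Rn n : (Rd < Rd.+1 + n)%N. Proof. by lia. Qed.

Lemma active_bounds n : (1 <= active n <= width Rd (Rd.+1 + n))%N.
Proof.
elim: n => [|n IHn]; first by rewrite /= addn0 width_gt0.
rewrite /=; have W := widthS (Rn n); rewrite addnS W.
by case: ifP => // _; case: ifP => // _; lia.
Qed.

Let active_node n : is_node Rd ((Rd.+1 + n)%N, active n).
Proof. by rewrite /is_node Rn active_bounds. Qed.

(* This counts the stages since the storage was last empty or full. *)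
Definition multiplicity (n : nat) : R :=
  (minn (active n) (width Rd (Rd.+1 + n) + 1 - active n))%:R.

Lemma multiplicity0 : multiplicity 0 = 1.
Proof. by rewrite /multiplicity /= addn0 /width (_ : minn _ _ = 1%N)//; lia. Qed.

(** A middle edge raises the index by one and the width by two, so both arguments of the minimum
    grow by one. The other edges lead to an extreme index, where the minimum is 1. *)
Lemma multiplicityS n :
  multiplicity n.+1 = if x - B < gap n <= x then multiplicity n + 1 else 1.
Proof.
have ab := active_bounds n; rewrite /multiplicity [active n.+1]/= !addnS widthS//.
have [xg|gx] := ltP x (gap n).
  by rewrite andbF (_ : minn _ _ = 1%N)//; lia.
rewrite andbT; case: ifP => _; last by rewrite (_ : minn _ _ = 1%N)//; lia.
by rewrite natr1; congr (_%:R); lia.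
Qed.

Hypothesis hB : 0 <= B.

Lemma deficit_active n : deficit x (Rd.+1 + n) (active n) w = gap n.
Proof.
elim: n => [|n IHn].
  by rewrite addn0 /= leqnn /residual /deficits addn0 subr0.
have [[lE mE] rE] := deficit_children D B x w (active_node n).
rewrite [active _]/= [RHS]/residual [deficits w n.+1]/deficits addnS.
have [xg|gx] := ltP x (gap n).
  by rewrite level_shortage// subr0; exact: lE.
have [xBg|gxB] := ltP (x - B) (gap n).
  by rewrite level_surplus ?xBg// -IHn; exact: mE.
by rewrite level_full//; exact: rE.
Qed.

(** As [B] is nonnegative, the three intervals partition the line, so the whole weight of a node
    passes to exactly one child. *)
Lemma weight_active n k : (1 <= k <= width Rd (Rd.+1 + n))%N ->
  weight x (Rd.+1 + n) k w = (k == active n)%:R.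
Proof.
elim: n k => [k|n IHn k].
  by rewrite addn0 /= leqnn /width => k1; have -> : k = 1%N by lia.
have W := widthS (Rn n); have ab := active_bounds n.
have sumE (g : nat -> R) :
  \sum_(1 <= l < (width Rd (Rd.+1 + n)).+1) weight x (Rd.+1 + n) l w * g l =
  g (active n).
  rewrite (bigD1_seq (active n)) ?iota_uniq ?mem_index_iota// IHn// eqxx mul1r.
  rewrite big_nat_cond big1; first exact: addr0.
  move=> l /andP[lw la].
  by rewrite IHn ?(negPf la) ?mul0r//; lia.
rewrite addnS => kw; rewrite weightS//.
rewrite (sumE (fun l => (x < deficit x (Rd.+1 + n) l w)%R%:R)).
rewrite (sumE (fun l => (deficit x (Rd.+1 + n) l w <= x - B)%R%:R)).
rewrite deficit_active [active n.+1]/= addnS.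
have [xg|gx] := ltP x (gap n).
  have [//|k1] := eqVneq k 1%N.
  have [kK|kK] := eqVneq k (width Rd (Rd.+1 + n).+1).
    by rewrite (_ : (_ <= _) = false)//; have := hB; lra.
  rewrite IHn; last by lia.
  have [->|_] := eqVneq k.-1 (active n); last by rewrite mul0r.
  by rewrite deficit_active (leNgt (gap n)) xg andbF mulr0.
have [xBg|gxB] := ltP (x - B) (gap n).
  have [->|k1] := eqVneq k 1%N.
    by rewrite (_ : (_ == _) = false)//; apply/eqP; lia.
  have [kK|kK] := eqVneq k (width Rd (Rd.+1 + n).+1).
    by rewrite (_ : (k == _) = false)//; apply/eqP; lia.
  rewrite IHn; last by lia.
  rewrite (_ : (k == (active n).+1) = (k.-1 == active n)); last by lia.
  have [->|_] := eqVneq k.-1 (active n); last by rewrite mul0r.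
  by rewrite deficit_active xBg gx mulr1.
have [->|k1] := eqVneq k 1%N; first by rewrite W.
have [//|kK] := eqVneq k (width Rd (Rd.+1 + n).+1).
rewrite IHn; last by lia.
have [->|_] := eqVneq k.-1 (active n); last by rewrite mul0r.
by rewrite deficit_active ltNge gxB mulr0.
Qed.

Lemma sum_weight_active n (F : nat -> R) :
  \sum_(1 <= k < (width Rd (Rd.+1 + n)).+1) F k * weight x (Rd.+1 + n) k w =
  F (active n).
Proof.
have ab := active_bounds n.
rewrite (bigD1_seq (active n)) ?iota_uniq ?mem_index_iota// weight_active// eqxx mulr1.
rewrite big_nat_cond big1; first exact: addr0.
move=> l /andP[lw la].
by rewrite weight_active ?(negPf la) ?mulr0//; lia.
Qed.

Lemma lattice_costE :
  lattice_cost x w = \sum_(i < T) Num.max (gap i - x) 0.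
Proof.
rewrite /lattice_cost sum_stages; apply: eq_bigr => i _.
rewrite (sum_weight_active _ (fun k => Num.max (deficit x (Rd.+1 + i) k w - x) 0)).
by rewrite deficit_active.
Qed.

Lemma lattice_slopeE :
  lattice_slope x w = \sum_(i < T) (x < gap i)%R%:R * multiplicity i.
Proof.
rewrite /lattice_slope sum_stages; apply: eq_bigr => i _.
rewrite mulrC -(deficit_active i) -(sum_weight_active _ (fun k =>
  (minn k (width Rd (Rd.+1 + i) + 1 - k))%:R *
  (x < deficit x (Rd.+1 + i) k w)%R%:R)).
rewrite big_nat_cond [RHS]big_nat_cond; apply: eq_bigr => k.
rewrite andbT ltnS => kw.
by rewrite -big_distrr/= -sum_in_box// mulrA.
Qed.

End fixed_outcome.

Hypothesis hB : 0 <= B.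

Lemma lattice_cost_subgradient (x y : R) (w : Omega) (b : nat -> R) :
  b 0 = 0 -> (forall i, 0 <= b i <= B) ->
  lattice_cost x w - (y - x) * lattice_slope x w <=
  \sum_(i < T) Num.max (deficits w i - y + (b i.+1 - b i)) 0.
Proof.
move=> b0 bB; rewrite lattice_costE// lattice_slopeE//.
by apply: greedy_subgradient => //; [exact: multiplicity0|exact: multiplicityS].
Qed.

(** With the greedy levels at supply [y] taken for [b], the general bound has the lattice cost at
    [y] on its right-hand side. *)
Lemma lattice_cost_convex (x y : R) (w : Omega) :
  lattice_cost x w - (y - x) * lattice_slope x w <= lattice_cost y w.
Proof.
have lB i : 0 <= level (deficits w) B y i <= B by exact: level_bounds.
rewrite [leRHS]lattice_costE// -(eq_bigr _ (fun i _ => greedy_cost _ _ _ _))//.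
exact: lattice_cost_subgradient.
Qed.

Lemma lattice_cost_ge0 (x : R) (w : Omega) : 0 <= lattice_cost x w.
Proof. by rewrite lattice_costE// sumr_ge0// => i _; rewrite le_max lexx orbT. Qed.

Lemma lattice_cost_le (x : R) (w : Omega) :
  lattice_cost x w <= \sum_(i < T) (Num.max (deficits w i) 0 + `|x|).
Proof.
rewrite lattice_costE//; apply: ler_sum => i _.
have /andP[l0 _] := level_bounds (deficits w) x hB i.
have := ler_norm (- x); rewrite normrN => nx.
have m1 : deficits w i <= Num.max (deficits w i) 0 by rewrite le_max lexx.
have m0 : 0 <= Num.max (deficits w i) 0 by rewrite le_max lexx orbT.
by rewrite ge_max /residual; apply/andP; split; [lra|rewrite addr_ge0].
Qed.

Lemma lattice_slope_bounds (x : R) (w : Omega) :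
  0 <= lattice_slope x w <= \sum_(i < T) (width Rd (Rd.+1 + i))%:R.
Proof.
rewrite lattice_slopeE//; apply/andP; split.
  by apply: sumr_ge0 => i _; rewrite mulr_ge0// /multiplicity.
apply: ler_sum => i _.
have ab := active_bounds x w i.
apply: (@le_trans _ _ (multiplicity x w i)); first by rewrite ler_piMl// lern1 leq_b1.
by rewrite /multiplicity ler_nat; lia.
Qed.

(** The subgradient inequality is used at both points, the slopes being bounded uniformly in the
    outcome. *)
Lemma lattice_cost_lipschitz (x y : R) (w : Omega) :
  `|lattice_cost x w - lattice_cost y w| <=
  (\sum_(i < T) (width Rd (Rd.+1 + i))%:R) * `|x - y|.
Proof.
set K := \sum_(i < T) _.
have half z z' : lattice_cost z w - lattice_cost z' w <= K * `|z - z'|.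
  have /andP[s0 sK] := lattice_slope_bounds z w.
  have := lattice_cost_convex z z' w.
  have : (z' - z) * lattice_slope z w <= `|z - z'| * K.
    apply: (@le_trans _ _ (`|z - z'| * lattice_slope z w)).
      by rewrite ler_wpM2r// distrC ler_norm.
    by rewrite ler_wpM2l.
  by lra.
by rewrite ler_norml; have := half x y; have := half y x; rewrite (distrC y); lra.
Qed.

End greedy_lattice.

(** * Measurability and integrability *)

Section measurability.
Context {d : measure_display} {U : measurableType d} {R : realType}.
Variables (Rd : nat) (D : nat -> U -> R) (B x : R).

Lemma measurable_natr_bool (b : U -> bool) : measurable_fun setT b ->
  measurable_fun setT (fun w => (b w)%:R : R).
Proof.
move=> mb; rewrite (_ : (fun _ => _) = fun w => if b w then 1 else 0 : R).
  by apply: measurable_fun_ifT => //; exact: measurable_cst.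
by apply/funext => w; case: (b w).
Qed.

Lemma measurable_all (I : eqType) (s : seq I) (p : I -> U -> bool) :
  (forall i, i \in s -> measurable_fun setT (p i)) ->
  measurable_fun setT (fun w => all (p ^~ w) s).
Proof.
elim: s => [|i s IHs] mp /=; first exact: measurable_cst.
apply: measurable_and; first by apply: mp; rewrite mem_head.
by apply: IHs => j js; apply: mp; rewrite inE js orbT.
Qed.

(** The measurable space is arbitrary, so that the lemma also applies to the sigma-algebra [Y t] and
    yields adaptedness. *)
Lemma measurable_level n :
  (forall i, (i < n)%N -> measurable_fun setT (D (Rd.+1 + i)%N)) ->
  measurable_fun setT (fun w => level (deficits Rd D w) B x n).
Proof.
elim: n => [|n IHn] mD; first exact: measurable_cst.
apply: measurable_minr; first exact: measurable_cst.
apply: measurable_maxr; first exact: measurable_cst.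
apply: measurable_funB; last exact: mD.
by apply: measurable_funD => //; apply: IHn => i ni; apply: mD; lia.
Qed.

Lemma measurable_deficit t k : (Rd < t)%N ->
  (forall s, (Rd < s <= t)%N -> measurable_fun setT (D s)) ->
  measurable_fun setT (deficit Rd D B x t k).
Proof.
elim: t k => // t IHt k Rt mD.
have mDt : measurable_fun setT (D t.+1) by apply: mD; lia.
have [tR|Rt'] := leqP t Rd.
  by rewrite (_ : deficit _ _ _ _ _ _ = D t.+1)//; apply/funext => w /=; rewrite tR.
have [k1|k1] := eqVneq k 1%N.
  rewrite (_ : deficit _ _ _ _ _ _ = D t.+1)//; apply/funext => w /=.
  by rewrite k1 if_same.
have [kK|kK] := eqVneq k (width Rd t.+1).
  rewrite (_ : deficit _ _ _ _ _ _ = fun w => D t.+1 w - B).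
    by apply: measurable_funB => //; exact: measurable_cst.
  by apply/funext => w /=; rewrite leqNgt Rt' (negPf k1) kK eqxx.
rewrite (_ : deficit _ _ _ _ _ _ =
    fun w => D t.+1 w - (x - deficit Rd D B x t k.-1 w)).
  apply: measurable_funB => //; apply: measurable_funB; first exact: measurable_cst.
  by apply: IHt => // s st; apply: mD; lia.
by apply/funext => w /=; rewrite leqNgt Rt' (negPf k1) (negPf kK).
Qed.

Lemma measurable_in_bounds q u :
  measurable_fun setT (deficit Rd D B x u.1 u.2) ->
  measurable_fun setT (fun w => in_bounds Rd D B x w q u).
Proof.
move=> mdel; apply: measurable_and.
  case: (lower_bound Rd B x q u) => [a||] /=.
  - under eq_fun do rewrite lte_fin.
    by apply: measurable_fun_ltr => //; exact: measurable_cst.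
  - exact: measurable_cst.
  - by under eq_fun do rewrite ltNyr; exact: measurable_cst.
case: (upper_bound Rd B x q u) => [a||] /=.
- under eq_fun do rewrite lee_fin.
  by apply: measurable_fun_ler => //; exact: measurable_cst.
- by under eq_fun do rewrite leey; exact: measurable_cst.
- exact: measurable_cst.
Qed.

Section boxes.
Variables (t k : nat) (j : 'I_(size (paths_to Rd t k))).
Hypotheses (Rt : (Rd < t)%N).
Hypothesis mD : forall s, (Rd < s <= t)%N -> measurable_fun setT (D s).

Let measurable_path u : u \in nth [::] (paths_to Rd t k) j ->
  measurable_fun setT
    (fun w => in_bounds Rd D B x w (nth [::] (paths_to Rd t k) j) u).
Proof.
move=> uq; apply: measurable_in_bounds.
have [qn _] := mem_paths_to j; have [/andP[Ru _] [ut _]] := root_paths_nodes qn uq.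
have ut' : (u.1 <= t)%N by apply: leq_trans ut _; lia.
apply: measurable_deficit => // s /andP[Rs su]; apply: mD.
by rewrite Rs (leq_trans su).
Qed.

Lemma measurable_in_box : measurable_fun setT (in_box D B x j).
Proof.
rewrite (_ : in_box D B x j = fun w =>
  all (in_bounds Rd D B x w (nth [::] (paths_to Rd t k) j))
    (nth [::] (paths_to Rd t k) j)); last by apply/funext => w; exact: in_boxE.
by apply: measurable_all; exact: measurable_path.
Qed.

Lemma measurable_in_box_except i : measurable_fun setT (in_box_except D B x i j).
Proof.
rewrite (_ : in_box_except D B x i j = fun w =>
  all (fun v => (v == nth (Defs.root Rd) (nodes_upto Rd t) i) ||
      in_bounds Rd D B x w (nth [::] (paths_to Rd t k) j) v)
    (nth [::] (paths_to Rd t k) j)); last by apply/funext => w; exact: in_box_exceptE.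
apply: measurable_all => u uq; apply: measurable_or; first exact: measurable_cst.
exact: measurable_path.
Qed.

Lemma measurable_deficit_eq i (a : \bar R) :
  measurable_fun setT (fun w => ((deficit_vector Rd D B x t w i 0)%:E == a)).
Proof.
under eq_fun do rewrite mxE.
have ni : nth (Defs.root Rd) (nodes_upto Rd t) i \in nodes_upto Rd t.
  by rewrite mem_nth// size_nodes_upto.
have /allpairsPdep[s [m [sI _ vE]]] := ni.
have mdel : measurable_fun setT (deficit Rd D B x s m).
  move: sI; rewrite mem_iota => st.
  by apply: measurable_deficit => [|z zs]; [lia|apply: mD; lia].
rewrite vE/=; case: a => [a||].
- under eq_fun do rewrite eqe.
  by apply: measurable_fun_eqr => //; exact: measurable_cst.
- exact: measurable_cst.
- exact: measurable_cst.
Qed.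

Lemma measurable_boundary_box i : measurable_fun setT (fun w =>
  (deficit Rd D B x t k w - x) *
  (dupper B x i j *
     ((deficit_vector Rd D B x t w i 0)%:E == upper_mx Rd B x t k i j)%:R -
   dlower B x i j *
     ((deficit_vector Rd D B x t w i 0)%:E == lower_mx Rd B x t k i j)%:R) *
  (in_box_except D B x i j w)%:R).
Proof.
apply: measurable_funM; last exact/measurable_natr_bool/measurable_in_box_except.
apply: measurable_funM.
  by apply: measurable_funB; [exact: measurable_deficit|exact: measurable_cst].
by apply: measurable_funB; (apply: measurable_funM; first exact: measurable_cst);
  exact/measurable_natr_bool/measurable_deficit_eq.
Qed.

End boxes.

Lemma measurable_lattice_cost T : 0 <= B ->
  (forall s, (Rd < s <= Rd + T)%N -> measurable_fun setT (D s)) ->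
  measurable_fun setT (lattice_cost Rd T D B x).
Proof.
move=> hB mD; rewrite (_ : lattice_cost _ _ _ _ _ = fun w =>
    \sum_(i < T) Num.max (residual (deficits Rd D w) B x i - x) 0); last first.
  by apply/funext => w; exact: lattice_costE.
apply: measurable_sum => i.
apply: measurable_maxr; last exact: measurable_cst.
apply: measurable_funB; last exact: measurable_cst.
apply: measurable_funB; first by apply: mD; have := ltn_ord i; lia.
by apply: measurable_level => m mi; apply: mD; have := ltn_ord i; lia.
Qed.

End measurability.

(** * Optimality of the greedy control and the cost-to-go *)

Section expected_cost.
Context {d : measure_display} {Omega : measurableType d} {R : realType}.
Variables (P : probability Omega R) (Rd T : nat) (Y : nat -> set (set Omega)).
Variables (D : nat -> Omega -> R) (B c : R).
Hypotheses (hB : 0 <= B) (hc : 0 < c).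
Hypothesis hY : forall t, (1 <= t <= Rd + T + 1)%N ->
  sigma_algebra setT (Y t) /\ Y t `<=` measurable.
Hypothesis hYnested : forall s t, (1 <= s)%N -> (s <= t)%N ->
  (t <= Rd + T + 1)%N -> Y s `<=` Y t.
Hypothesis hD : forall t, storage_stage Rd T t -> measurable_wrt (Y t) (D t).
Hypothesis hDint : forall t, storage_stage Rd T t ->
  P.-integrable setT (fun w => (Num.max (D t w) 0)%:E).
Local Notation cost := (lattice_cost Rd T D B).

Lemma measurable_demand t : (Rd < t <= Rd + T)%N -> measurable_fun setT (D t).
Proof.
move=> ht; have [_ Ym] := hY (t := t) ltac:(lia).
exact: measurable_wrt_measurable Ym (hD ht).
Qed.

Definition greedy_level (x : R) (t : nat) (w : Omega) : R :=
  level (deficits Rd D w) B x (t - Rd.+1).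

Definition greedy_control (x : R) (t : nat) (w : Omega) : R :=
  greedy_level x t.+1 w - greedy_level x t w.

(** The level after stage [t] involves the deficits up to stage [t] only, which are measurable for
    [Y t] by nestedness. *)
Lemma greedy_feasible x : feasible Rd T Y B (greedy_control x).
Proof.
split=> [t ht|]; last first.
  exists (greedy_level x); split => [w|t w ht].
    by rewrite /greedy_level subnn.
  rewrite /greedy_control; split; first by ring.
  have /andP[? ?] := level_bounds (deficits Rd D w) x hB (t.+1 - Rd.+1).
  have /andP[? ?] := level_bounds (deficits Rd D w) x hB (t - Rd.+1).
  by rewrite /greedy_level; lra.
have [sY _] := hY (t := t) ltac:(move: ht; rewrite /storage_stage; lia).
have mD s : (Rd < s <= t)%N -> measurable_wrt (Y t) (D s).
  move: ht; rewrite /storage_stage => ht hs.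
  apply: (@measurable_wrt_sub _ _ _ (Y s)) => //.
    by apply: hYnested; lia.
  by apply: hD; rewrite /storage_stage; lia.
move: ht; rewrite /storage_stage => ht.
by apply: measurable_funB; apply: (@measurable_level _ (g_sigma_algebraType (Y t)));
  move=> i hi; apply: mD; lia.
Qed.

Lemma greedy_storage_cost xR1 w :
  storage_cost Rd T D c xR1 (greedy_control (xR1 / T%:R)) w =
  c * cost (xR1 / T%:R) w.
Proof.
rewrite /storage_cost lattice_costE// sum_stages; congr (_ * _).
apply: eq_bigr => i _; rewrite -greedy_cost//.
rewrite /greedy_control /greedy_level (_ : (Rd.+1 + i).+1 - Rd.+1 = i.+1)%N; last by lia.
by rewrite (_ : Rd.+1 + i - Rd.+1 = i)%N; last by lia.
Qed.

Lemma feasible_cost_ge xR1 u w : feasible Rd T Y B u ->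
  c * cost (xR1 / T%:R) w <= storage_cost Rd T D c xR1 u w.
Proof.
move=> [_ [b [b0 bu]]]; rewrite /storage_cost ler_pM2l// sum_stages.
(* The levels are controlled only up to the one after the last storage stage, which has index [T];
   beyond it, 0 keeps them within capacity. *)
pose b' i := if (i <= T)%N then b (Rd.+1 + i)%N w else 0.
have b'0 : b' 0 = 0 by rewrite /b' /= addn0.
have b'B i : 0 <= b' i <= B.
  rewrite /b'; case: i => [|i]; first by rewrite /= addn0 b0 lexx.
  case: ifP => [iT|_]; last by rewrite lexx.
  rewrite addnS; have [|-> /andP[]] := bu (Rd.+1 + i)%N w.
    by rewrite /storage_stage; lia.
  by lra.
have := lattice_cost_subgradient Rd T D hB (xR1 / T%:R) (xR1 / T%:R) w b'0 b'B.
rewrite subrr mul0r subr0 => /le_trans; apply; apply: ler_sum => i _.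
rewrite /b' (ltnW (ltn_ord i)) ltn_ord addnS.
have [|-> _] := bu (Rd.+1 + i)%N w.
  by rewrite /storage_stage; have := ltn_ord i; lia.
by rewrite (_ : b _ w + _ - b _ w = u (Rd.+1 + i)%N w)//; ring.
Qed.

Let integrable_demands (a : R) : P.-integrable setT
  (EFin \o (fun w => \sum_(i < T) (Num.max (D (Rd.+1 + i)%N w) 0 + a))).
Proof.
rewrite (_ : _ \o _ = fun w =>
    (\sum_(i < T) ((Num.max (D (Rd.+1 + i)%N w) 0)%:E + a%:E))%E); last first.
  by apply/funext => w /=; rewrite -sumEFin.
apply: integrable_sum => // i _; apply: integrableD => //.
  by apply: hDint; rewrite /storage_stage; have := ltn_ord i; lia.
exact: finite_measure_integrable_cst.
Qed.

Lemma integrable_lattice_cost x : P.-integrable setT (EFin \o cost x).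
Proof.
apply: integrable_dominated (integrable_demands `|x|).
  by apply: measurable_lattice_cost => // s; exact: measurable_demand.
by move=> w; rewrite ger0_norm ?lattice_cost_ge0//; exact: lattice_cost_le.
Qed.

Lemma integrableZ_lattice_cost x : P.-integrable setT (EFin \o (fun w => c * cost x w)).
Proof. exact: (integrableZl measurableT c (integrable_lattice_cost x)). Qed.

(** The level is nonnegative, so a control is at most [B] and the shortfall at most the positive
    part of the deficit plus [|x| + B]. *)
Lemma integrable_storage_cost xR1 u : feasible Rd T Y B u ->
  P.-integrable setT (EFin \o storage_cost Rd T D c xR1 u).
Proof.
move=> [mu [b [b0 bu]]].
apply: (@integrable_dominated _ _ _ P _ (fun w => c * \sum_(i < T)
  (Num.max (D (Rd.+1 + i)%N w) 0 + (`|xR1 / T%:R| + B)))); last first.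
- exact: (integrableZl measurableT c (integrable_demands (`|xR1 / T%:R| + B))).
- move=> w; rewrite /storage_cost normrM (gtr0_norm hc) ler_pM2l// sum_stages.
  rewrite ger0_norm ?sumr_ge0// => [|i _]; last by rewrite le_max lexx orbT.
  apply: ler_sum => i _; set x := xR1 / T%:R.
  have iT : storage_stage Rd T (Rd.+1 + i) by rewrite /storage_stage; have := ltn_ord i; lia.
  have b_ge0 : 0 <= b (Rd.+1 + i)%N w.
    case: (nat_of_ord i) iT => [|m] mT; first by rewrite addn0 b0.
    have [|bE /andP[]] := bu (Rd.+1 + m)%N w.
      by move: mT; rewrite /storage_stage; lia.
    by rewrite addnS bE; lra.
  have [_ /andP[_ uB]] := bu _ w iT.
  have := ler_norm (- x); rewrite normrN => nx.
  have m1 : D (Rd.+1 + i)%N w <= Num.max (D (Rd.+1 + i)%N w) 0 by rewrite le_max lexx.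
  have m0 : 0 <= Num.max (D (Rd.+1 + i)%N w) 0 by rewrite le_max lexx orbT.
  have x0 : 0 <= `|x| by [].
  by rewrite ge_max; apply/andP; split; have := hB; lra.
- apply: measurable_funM; first exact: measurable_cst.
  rewrite (_ : (fun _ => _) = fun w => \sum_(i < T)
      Num.max (D (Rd.+1 + i)%N w - xR1 / T%:R + u (Rd.+1 + i)%N w) 0); last first.
    by apply/funext => w; rewrite sum_stages.
  apply: measurable_sum => i.
  have iT : storage_stage Rd T (Rd.+1 + i) by rewrite /storage_stage; have := ltn_ord i; lia.
  apply: measurable_maxr; last exact: measurable_cst.
  apply: measurable_funD.
    by apply: measurable_funB; [exact: measurable_demand|exact: measurable_cst].
  have [_ Ym] := hY (t := (Rd.+1 + i)%N) ltac:(move: iT; rewrite /storage_stage; lia).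
  exact: measurable_wrt_measurable Ym (mu _ iT).
Qed.

(** The infimum is attained: the greedy control is feasible and no feasible control costs less for
    any outcome, so its conditional expectation is the essential infimum. *)
Lemma cost_to_go_condexp xR1 :
  is_condexp P (Y Rd.+1) (fun w => c * cost (xR1 / T%:R) w)
    (cost_to_go P Rd T Y D B c xR1).
Proof.
have [sY Ym] := hY (t := Rd.+1) ltac:(lia).
set x := xR1 / T%:R; set F := fun w => c * cost x w.
have FE : storage_cost Rd T D c xR1 (greedy_control x) = F.
  by apply/funext => w; exact: greedy_storage_cost.
have ZP := is_condexp_condexp sY Ym (integrableZ_lattice_cost x).
have [_ _ mZ _] := ZP.
have [] := @essential_inf_min _ _ _ P (Y Rd.+1)
  [set condexp P (Y Rd.+1) (storage_cost Rd T D c xR1 u) | u in feasible Rd T Y B]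
  (condexp P (Y Rd.+1) F) _ mZ.
- by exists (greedy_control x); [exact: greedy_feasible|rewrite FE].
- move=> _ [u fu <-].
  apply: (is_condexp_le sY Ym ZP).
    by apply: is_condexp_condexp => //; exact: integrable_storage_cost.
  by apply: aeW => w; exact: feasible_cost_ge.
move=> mJ JZ; apply: (is_condexp_ae_eq Ym ZP) => //.
  by have /measurable_int/measurable_EFinP := integrableZ_lattice_cost x.
exact: aeW.
Qed.

Lemma integrable_in_box x t k (j : 'I_(size (paths_to Rd t k))) :
  storage_stage Rd T t ->
  P.-integrable setT (EFin \o (fun w => (in_box D B x j w)%:R)).
Proof.
rewrite /storage_stage => tT.
apply: (@integrable_dominated _ _ _ P _ (cst 1)); last 1 first.
- exact: finite_measure_integrable_cst.
- apply: measurable_natr_bool; apply: measurable_in_box => [|s st]; first by lia.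
  by apply: measurable_demand; lia.
- by move=> w; rewrite ger0_norm// lern1 leq_b1.
Qed.

Lemma integrable_boundary_box x t k (j : 'I_(size (paths_to Rd t k))) i :
  storage_stage Rd T t ->
  P.-integrable setT (EFin \o (fun w => (deficit Rd D B x t k w - x) *
    (dupper B x i j *
       ((deficit_vector Rd D B x t w i 0)%:E == upper_mx Rd B x t k i j)%:R -
     dlower B x i j *
       ((deficit_vector Rd D B x t w i 0)%:E == lower_mx Rd B x t k i j)%:R) *
    (in_box_except D B x i j w)%:R)).
Proof.
rewrite /storage_stage => tT.
set a := `|dupper B x i j| + `|dlower B x i j|.
apply: (@integrable_dominated _ _ _ P _ (fun w => a * (Num.max (D t w) 0 + `|x|)));
  last 1 first.
- have iD : P.-integrable setT (EFin \o (fun w => Num.max (D t w) 0 + `|x|)).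
    have ix : P.-integrable setT (EFin \o cst `|x|).
      exact: finite_measure_integrable_cst.
    exact: (integrableD measurableT (hDint tT) ix).
  exact: (integrableZl measurableT a iD).
- apply: measurable_boundary_box => [|s st]; first by lia.
  by apply: measurable_demand; lia.
- by move=> w; rewrite (mulrC a); apply: boundary_box_bound => //; lia.
Qed.

(** * Conditioning on a dispatch stage, and the subgradient *)

Section dispatch.
Variable r : nat.
Hypothesis hr : (1 <= r <= Rd)%N.
Local Notation Jhat := (expected_cost_to_go P Rd T Y D B c r).

Let rY : sigma_algebra setT (Y r) /\ Y r `<=` measurable.
Proof. by apply: hY; lia. Qed.

Let rRd : Y r `<=` Y Rd.+1. Proof. by apply: hYnested; lia. Qed.

Lemma expected_cost_to_go_condexp xR1 :
  is_condexp P (Y r) (fun w => c * cost (xR1 / T%:R) w) (Jhat xR1).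
Proof.
have [sY Ym] := rY; have JP := cost_to_go_condexp xR1; have [_ iJ _ _] := JP.
exact: is_condexp_tower rRd JP (is_condexp_condexp sY Ym iJ).
Qed.

Lemma expected_cost_to_goE xR1 : {ae P, forall w,
  Jhat xR1 w = c * condexp P (Y r) (cost (xR1 / T%:R)) w}.
Proof.
have [sY Ym] := rY; have iC := integrable_lattice_cost (xR1 / T%:R).
apply: (is_condexp_unique sY Ym (expected_cost_to_go_condexp xR1)
  (is_condexpZ Ym c (is_condexp_condexp sY Ym iC))).
exact: aeW.
Qed.

Definition expected_slope (x : R) (w : Omega) : R :=
  \sum_(Rd.+1 <= t < (Rd + T).+1) \sum_(1 <= k < (width Rd t).+1)
  \sum_(j < size (paths_to Rd t k))
    ((minn k (width Rd t + 1 - k))%:R *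
       condexp P (Y r) (fun w' => (in_box D B x j w')%:R) w
     + \sum_(i < (t - Rd) ^ 2)
         condexp P (Y r) (fun w' =>
           (deficit Rd D B x t k w' - x) *
           (dupper B x i j *
              ((deficit_vector Rd D B x t w' i 0)%:E
                 == upper_mx Rd B x t k i j)%:R
            - dlower B x i j *
              ((deficit_vector Rd D B x t w' i 0)%:E
                 == lower_mx Rd B x t k i j)%:R) *
           (in_box_except D B x i j w')%:R) w).

(** The boundary terms vanish as a sum, not one by one. They are added to the slope first, and the
    conditional expectation is then taken term by term, each term being integrable. *)
Lemma lattice_slope_condexp x :
  is_condexp P (Y r) (lattice_slope Rd T D B x) (expected_slope x).
Proof.
have [sY Ym] := rY.
have -> : lattice_slope Rd T D B x = fun w =>
  \sum_(Rd.+1 <= t < (Rd + T).+1) \sum_(1 <= k < (width Rd t).+1)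
  \sum_(j < size (paths_to Rd t k))
    ((minn k (width Rd t + 1 - k))%:R * (in_box D B x j w)%:R
     + \sum_(i < (t - Rd) ^ 2)
           (deficit Rd D B x t k w - x) *
           (dupper B x i j *
              ((deficit_vector Rd D B x t w i 0)%:E
                 == upper_mx Rd B x t k i j)%:R
            - dlower B x i j *
              ((deficit_vector Rd D B x t w i 0)%:E
                 == lower_mx Rd B x t k i j)%:R) *
           (in_box_except D B x i j w)%:R).
  apply/funext => w; rewrite /lattice_slope big_nat_cond [RHS]big_nat_cond.
  apply: eq_bigr => t; rewrite andbT => tT.
  under [RHS]eq_bigr do rewrite big_split/=.
  by rewrite big_split/= sum_boundary_box ?addr0//; lia.
apply: is_condexp_sum => // t; rewrite mem_index_iota => tT.
apply: is_condexp_sum => // k _; apply: is_condexp_sum => // j _.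
apply: is_condexpD => //.
  apply: is_condexpZ => //; apply: is_condexp_condexp => //.
  exact: integrable_in_box.
apply: is_condexp_sum => // i _; apply: is_condexp_condexp => //.
exact: integrable_boundary_box.
Qed.

(** In terms of the accumulated energy, the cost is Lipschitz with constant [c * (K / T)] for every
    outcome. *)
Lemma expected_cost_version : exists Jt : R -> Omega -> R,
  (forall xR1, is_condexp P (Y r) (fun w => c * cost (xR1 / T%:R) w) (Jt xR1)) /\
  (forall w, continuous (Jt ^~ w)).
Proof.
have [sY Ym] := rY.
pose K : R := \sum_(i < T) (width Rd (Rd.+1 + i))%:R.
apply: (@condexp_lipschitz_version _ _ _ P (Y r)
  (fun y w => c * cost (y / T%:R) w) (c * (K / T%:R)) sY Ym) => [y|y z w].
  exact: integrableZ_lattice_cost.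
rewrite -mulrBr normrM (gtr0_norm hc) -mulrA ler_pM2l//.
apply: le_trans (lattice_cost_lipschitz _ _ _ _ _ _ _) _ => //.
rewrite -mulrBl normrM (ger0_norm (x := T%:R^-1)) ?invr_ge0//.
by rewrite -/K mulrA mulrAC.
Qed.

(** The pathwise inequality passes to conditional expectations at each rational point; a single null
    set serves for all of them, and continuity of the paths extends the inequality to every real
    [y]. *)
Lemma expected_slope_subgradient (Jt : R -> Omega -> R) (X : set R) (xR1 : R) :
  (forall y, is_condexp P (Y r) (fun w => c * cost (y / T%:R) w) (Jt y)) ->
  (forall w, continuous (Jt ^~ w)) -> X xR1 ->
  {ae P, forall w, constrained_subgradient X (fun y => Jt y w) xR1
    (- (c / T%:R) * expected_slope (xR1 / T%:R) w)}.
Proof.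
move=> JtP Jtc Xx; have [sY Ym] := rY; set x := xR1 / T%:R.
pose g w := - (c / T%:R) * expected_slope x w.
have le_rat : {ae P, forall w, forall q : rat,
    Jt xR1 w + (ratr q - xR1) * g w <= Jt (ratr q) w}.
  apply: ae_forall_rat => q.
  have gP := is_condexpZ Ym (ratr q - xR1)
    (is_condexpZ Ym (- (c / T%:R)) (lattice_slope_condexp x)).
  apply: (is_condexp_le sY Ym (is_condexpD Ym (JtP xR1) gP) (JtP (ratr q))).
  apply: aeW => w /=.
  have := lattice_cost_convex Rd T D hB x (ratr q / T%:R) w.
  rewrite -(ler_pM2l hc) => /(le_trans _); apply.
  by rewrite le_eqVlt; apply/orP; left; apply/eqP; rewrite /x; ring.
apply: filterS le_rat => w wq; split=> // y _.
rewrite -subr_ge0 mulrC.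
apply: (@continuous_ge0_rat R (fun z => Jt z w - (Jt xR1 w + (z - xR1) * g w))).
  move=> z; apply: cvgB; first exact: Jtc.
  apply: cvgD; first exact: cvg_cst.
  by apply: cvgMl; apply: cvgB; [exact: cvg_id|exact: cvg_cst].
by move=> q; rewrite subr_ge0.
Qed.

End dispatch.

End expected_cost.

Theorem mainTheorem5 (d : measure_display) (Omega : measurableType d)
    (R : realType) (P : probability Omega R) (Rd T : nat)
    (Y : nat -> set (set Omega)) (D : nat -> Omega -> R) (B c : R) (r : nat)
    (hT : (0 < T)%N) (hB : 0 <= B) (hc : 0 < c) (hr : (1 <= r <= Rd)%N)
    (hY : forall t, (1 <= t <= Rd + T + 1)%N ->
      sigma_algebra setT (Y t) /\ Y t `<=` measurable)
    (hYnested : forall s t, (1 <= s)%N -> (s <= t)%N -> (t <= Rd + T + 1)%N ->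
      Y s `<=` Y t)
    (hD : forall t, storage_stage Rd T t -> measurable_wrt (Y t) (D t))
    (hDint : forall t, storage_stage Rd T t ->
      P.-integrable setT (fun w => (Num.max (D t w) 0)%:E)) :
  let Jhat := expected_cost_to_go P Rd T Y D B c r in
  let Dk := deficit Rd D B in
  let p := weight Rd D B in
  [/\ (* the matrices of bounds represent the indicators of the lattice paths *)
      forall (x : R) (t k : nat) (w : Omega),
        storage_stage Rd T t -> (1 <= k <= width Rd t)%N ->
        (x < Dk x t k w)%R%:R * p x t k w =
          \sum_(j < size (paths_to Rd t k)) (in_box D B x j w)%:R,
      (* first expression of the expected cost-to-go *)
      forall xR1 : R, let x := xR1 / T%:R in
        {ae P, forall w, Jhat xR1 w =
          c * condexp P (Y r) (fun w' =>
            \sum_(Rd.+1 <= t < (Rd + T).+1) \sum_(1 <= k < (width Rd t).+1)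
              Num.max (Dk x t k w' - x) 0 * p x t k w') w},
      (* second expression of the expected cost-to-go *)
      forall xR1 : R, let x := xR1 / T%:R in
        {ae P, forall w, Jhat xR1 w =
          c * condexp P (Y r) (fun w' =>
            \sum_(Rd.+1 <= t < (Rd + T).+1) \sum_(1 <= k < (width Rd t).+1)
              \sum_(j < size (paths_to Rd t k))
                (Dk x t k w' - x) * (in_box D B x j w')%:R) w} &
      (* Conditional expectations being defined up to null sets, the subgradient
         is that of the version of Jhat whose sample paths are continuous in
         xR1, which is unique up to indistinguishability. *)
      exists Jt : R -> Omega -> R,
        [/\ forall xR1, is_condexp P (Y r) (cost_to_go P Rd T Y D B c xR1)
                          (Jt xR1),
            forall xR1, {ae P, forall w, Jt xR1 w = Jhat xR1 w},
            forall w, continuous (fun xR1 => Jt xR1 w) &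
            forall (X : set R) (xR1 : R), X xR1 -> let x := xR1 / T%:R in
              {ae P, forall w,
                constrained_subgradient X (fun y => Jt y w) xR1
                  (- (c / T%:R) *
                   \sum_(Rd.+1 <= t < (Rd + T).+1)
                   \sum_(1 <= k < (width Rd t).+1)
                   \sum_(j < size (paths_to Rd t k))
                     ((minn k (width Rd t + 1 - k))%:R *
                        condexp P (Y r) (fun w' => (in_box D B x j w')%:R) w
                      + \sum_(i < (t - Rd) ^ 2)
                          condexp P (Y r) (fun w' =>
                            (Dk x t k w' - x) *
                            (dupper B x i j *
                               ((deficit_vector Rd D B x t w' i 0)%:E
                                  == upper_mx Rd B x t k i j)%:R
                             - dlower B x i j *
                               ((deficit_vector Rd D B x t w' i 0)%:E
                                  == lower_mx Rd B x t k i j)%:R) *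
                            (in_box_except D B x i j w')%:R) w))}]].

Proof.
move=> Jhat Dk p.
have first_expr xR1 : {ae P, forall w, Jhat xR1 w =
    c * condexp P (Y r) (lattice_cost Rd T D B (xR1 / T%:R)) w}.
  exact: expected_cost_to_goE.
split.
- by move=> x t k w tT kt; apply: sum_in_box => //; case/andP: tT.
- exact: first_expr.
(* The two integrands agree for every outcome: the positive part is the difference times the
   indicator of a shortage, and this indicator times the weight is the sum over paths. *)
- move=> xR1 x; rewrite [X in condexp P (Y r) X](_ : _ = lattice_cost Rd T D B x).
    exact: first_expr.
  apply/funext => w; apply/esym; rewrite /lattice_cost.
  rewrite big_nat_cond [RHS]big_nat_cond; apply: eq_bigr => t.
  rewrite andbT => tT; rewrite big_nat_cond [RHS]big_nat_cond.
  apply: eq_bigr => k; rewrite andbT ltnS => kt.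
  rewrite -big_distrr/= -sum_in_box//; last by lia.
  rewrite mulrA; congr (_ * _); rewrite /Dk -/x.
  have [xD|Dx] := ltP x (deficit Rd D B x t k w).
    by rewrite mulr1 max_l// subr_ge0 ltW.
  by rewrite mulr0 max_r// subr_le0.
have [Jt [JtP Jtc]] := expected_cost_version hB hc hY hD hDint hr.
exists Jt; split => //.
- move=> xR1.
  (* The version was built from the lattice cost; since the cost-to-go is a conditional expectation
     of that cost, it is also a version for the cost-to-go. *)
  apply: (is_condexp_tower_inv _ (cost_to_go_condexp hB hc hY hYnested hD hDint xR1)).
    by apply: hYnested; lia.
  exact: JtP.
- move=> xR1; have [sY Ym] : sigma_algebra setT (Y r) /\ Y r `<=` measurable by apply: hY; lia.
  apply: (is_condexp_unique sY Ym (JtP xR1)); last exact: aeW.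
  exact: expected_cost_to_go_condexp.
- move=> X xR1 Xx x; exact: expected_slope_subgradient.
Qed.
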